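(* Let $S$ be a finitely generated polynomial semigroup with unique minimal generating set $\mathcal{G}_S$, and put $C^*[S]:=\{c\in\mathbb{C}: g'(c)=0\text{ for some }g\in\mathcal{G}_S\}$, $C[S]:=\{c\in J(S): g'(c)=0\text{ for some }g\in\mathcal{G}_S\}$. Suppose that if $\sharp C^*[S]=1$ then $C[S]\cap\mathcal{E}(S)=\emptyset$, and that for some $z_0\in J(S)$ the orbit $O(z_0)$ of $z_0$ under $S$ is unbounded and is not dense in $\mathbb{C}$. Let $\mathcal{G}=\{g_1,g_2,\dots,g_N\}$ be a finite set of generators of $S$ and let $D:=\deg(g_1)+\dots+\deg(g_N)$. If each element of $S$ is of degree at least $2$, then $$\mathrm{diam}(J(S))>2\,|\Lambda(g_1)\Lambda(g_2)\cdots\Lambda(g_N)|^{\frac{1}{N-D}},$$ where $\mathrm{diam}(J(S))$ denotes the diameter of $J(S)$ with respect to the Euclidean metric on $\mathbb{C}$.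
   Context: Let $\widehat{\mathbb{C}}$ be the Riemann sphere. A rational semigroup is a subsemigroup (under composition) of the semigroup of holomorphic self-maps of $\widehat{\mathbb{C}}$ containing no constant maps. A rational semigroup $S$ is a polynomial semigroup if all its elements are polynomials, any degree-one element of $S$ has an attracting fixed point at $\infty$ (i.e., is $z\mapsto az+b$ with $|a|>1$), and $S$ contains at least one element of degree at least $2$. A set $\mathcal{G}\subseteq S$ generates $S$ if every element of $S$ is a finite (nonempty) composition of elements of $\mathcal{G}$. A finite generating set $\{g_1,\dots,g_N\}$ (distinct $g_i$) is minimal if no $g_i$ can be expressed as a composition of the remaining generators; every finitely generated polynomial semigroup $S$ has a unique minimal generating set, denoted $\mathcal{G}_S$. The Fatou set $F(S)$ is the largest open subset of $\widehat{\mathbb{C}}$ on which the functions in $S$ form a normal family, and the Julia set is $J(S):=\widehat{\mathbb{C}}\setminus F(S)$ (for finitely generated polynomial semigroups, $J(S)$ is a compact subset of $\mathbb{C}$). The orbit of $z\in\mathbb{C}$ is $O(z):=\{f(z): f\in S\}$. A point $z\in\widehat{\mathbb{C}}$ is exceptional if the set $\{x\in\widehat{\mathbb{C}}: g(x)=z\text{ for some }g\in S\}$ is finite; $\mathcal{E}(S)$ is the set of exceptional points. $\Lambda(g)$ denotes the coefficient of the highest-degree term of a polynomial $g$. *)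

(* Defs.v *)
(* Throughout, C is R[i] for an arbitrary R : realType. *)
From HB Require Import structures.
From mathcomp Require Import all_boot all_order all_algebra.
From mathcomp Require Import complex.
From mathcomp Require Import all_classical all_reals all_analysis.
Set Implicit Arguments.
Unset Strict Implicit.
Unset Printing Implicit Defensive.
Import Order.TTheory GRing.Theory Num.Theory.
Import numFieldNormedType.Exports.
Export numFieldNormedType.Exports.

Local Open Scope classical_set_scope.
Local Open Scope ring_scope.
Local Open Scope complex_scope.

(* The topology on R[i] is carried by the alias R[i]^o, whose norm takes its  *)
(* values in R[i]; [cabs] is the same modulus with values in R.               *)
Definition plane (R : realType) := (R[i])^o.

Definition cabs (R : realType) (z : R[i]) : R := Normc.normc z.

(* The Riemann sphere; None is the point at infinity. *)
Definition sphere (R : realType) := one_point_compactification (plane R).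

Definition chordal (R : realType) (x y : sphere R) : R :=
  match x, y with
  | Some z, Some w =>
      2 * cabs (z - w) /
        (Num.sqrt (1 + cabs z ^+ 2) * Num.sqrt (1 + cabs w ^+ 2))
  | Some z, None | None, Some z => 2 / Num.sqrt (1 + cabs z ^+ 2)
  | None, None => 0
  end.

(* The self-map of the sphere given by a nonconstant polynomial. *)
Definition sphere_map (R : realType) (g : {poly R[i]}) (x : sphere R) :
    sphere R :=
  if x is Some z then Some g.[z] else None.

(* As C is infinite, polynomial maps are identified with polynomials, and     *)
(* composition with [_ \Po _]. The last three clauses: no constant maps,      *)
(* infinity is attracting for degree one maps, some map has degree >= 2.      *)
Definition polynomial_semigroup (R : realType) (S : set {poly R[i]}) : Prop :=
  [/\ forall f g, S f -> S g -> S (f \Po g),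
      forall f, S f -> (1 < size f)%N,
      forall f, S f -> size f = 2%N -> 1 < cabs (lead_coef f)
    & exists2 f, S f & (2 < size f)%N].

Definition compositions (R : realType) (A : set {poly R[i]}) :
    set {poly R[i]} :=
  [set f | exists s : seq {poly R[i]},
     [/\ s != [::], forall g, g \in s -> A g
       & f = foldr (fun g h => g \Po h) 'X s]].

Definition generates (R : realType) (A S : set {poly R[i]}) : Prop :=
  A `<=` S /\ S `<=` compositions A.

(* Finite sets of polynomials are enumerated by duplicate-free sequences. *)
Definition generating_set (R : realType) (S : set {poly R[i]})
    (G : seq {poly R[i]}) : Prop :=
  uniq G /\ generates [set g | g \in G] S.

Definition finitely_generated (R : realType) (S : set {poly R[i]}) : Prop :=
  exists G, generating_set S G.

Definition minimal_generating_set (R : realType) (S : set {poly R[i]})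
    (G : seq {poly R[i]}) : Prop :=
  generating_set S G /\
  forall g, g \in G -> ~ compositions [set h | h \in G /\ h != g] g.

Definition normal_family (R : realType) (U : set (sphere R))
    (F : set (sphere R -> sphere R)) : Prop :=
  forall f : nat -> sphere R -> sphere R, (forall n, F (f n)) ->
  exists (phi : nat -> nat) (h : sphere R -> sphere R),
    (forall m n, (m < n)%N -> (phi m < phi n)%N) /\
    forall K : set (sphere R), compact K -> K `<=` U ->
    forall e : R, 0 < e ->
    exists N : nat, forall n, (N <= n)%N ->
      forall x, K x -> chordal (f (phi n) x) (h x) < e.

Definition fatou (R : realType) (S : set {poly R[i]}) : set (sphere R) :=
  \bigcup_(U in [set U | open U /\ normal_family U (@sphere_map R @` S)]) U.

Definition julia (R : realType) (S : set {poly R[i]}) : set (sphere R) :=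
  ~` fatou S.

(* The finite points of the Julia set; this is all of J(S) when S is a        *)
(* finitely generated polynomial semigroup.                                   *)
Definition juliaC (R : realType) (S : set {poly R[i]}) : set (plane R) :=
  [set z | julia S (Some z)].

Definition exceptional (R : realType) (S : set {poly R[i]}) :
    set (sphere R) :=
  [set z | finite_set [set x | exists2 g, S g & sphere_map g x = z]].

Definition semigroup_orbit (R : realType) (S : set {poly R[i]}) (z : R[i]) :
    set (plane R) :=
  [set f.[z] | f in S].

Definition Cstar (R : realType) (G : seq {poly R[i]}) : set (plane R) :=
  [set c | exists2 g, g \in G & g^`().[c] = 0].

Definition Ccrit (R : realType) (S : set {poly R[i]}) (G : seq {poly R[i]}) :
    set (plane R) :=
  [set c | juliaC S c /\ exists2 g, g \in G & g^`().[c] = 0].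

Definition degree (R : realType) (g : {poly R[i]}) : nat := (size g).-1.

Definition diam (R : realType) (A : set (plane R)) : \bar R :=
  ereal_sup [set (cabs (p.1 - p.2))%:E | p in A `*` A].

(* Main.v *)
(* A lower bound for the diameter comes from averaging polynomials over the   *)
(* fibres of an iterate.  If E is infinite, bounded and backward invariant    *)
(* under a monic g of degree at least 2, then for every polynomial P in two   *)
(* variables the supremum of |P| over E x E is at least the maximum of its    *)
(* leading form on the unit torus: averaging P^N over the fibres of g^n       *)
(* leaves a polynomial of bounded total degree, whose leading coefficients    *)
(* are recovered by divided differences on a fixed number of points of E.     *)
(* For P = x - y this gives diam E >= 2, hence by affine conjugation          *)
(* diam E >= 2 |a|^(-1/(d-1)) for a map of degree d and leading coefficient   *)
(* a, and the weighted geometric mean over the generators is the              *)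
(* non-strict form of the bound.  In the equality case, applying the same     *)
(* inequality to the sum of (x - y)^K over pairs of fibres of g, where x and  *)
(* y are nearly antipodal, forces every coefficient of the centred g below    *)
(* the leading one to vanish.  So each map of S is conjugate to z^d with E in *)
(* the closed unit disc; then the orbit of every point of E = J(S) is         *)
(* bounded, contrary to the hypothesis on z0.                                 *)
Require Import Defs.
From mathcomp Require Import all_boot all_order all_algebra.
From mathcomp Require Import complex.
From mathcomp Require Import all_classical all_reals all_analysis.
From mathcomp Require Import ring lra zify.
Import Order.TTheory GRing.Theory Num.Theory.
Import numFieldNormedType.Exports.
Local Open Scope classical_set_scope.
Local Open Scope ring_scope.
Local Open Scope complex_scope.

Set Implicit Arguments.
Unset Strict Implicit.
Unset Printing Implicit Defensive.

(** * The modulus and growth of powers *)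

(** J(S) is backward invariant under every map of S ([juliaC_backward]), and for an infinite bounded
    set this already bounds the diameter from below. By [torus_bound], a polynomial in two variables
    on E x E dominates its leading form on the unit torus; for x - y and a monic map this gives
    diameter at least 2 ([diam_ge2_of_monic]). After affine conjugation, a diameter of at most 2 rho
    forces |a| rho^(d-1) >= 1 for every map of degree d and leading coefficient a
    ([backward_invariant_diam]).

    Suppose diam J(S) <= 2 rho, with 2 rho the claimed bound. The product of |a| rho^(d-1) over the
    generators is exactly 1, so each factor is 1, and [compositions_lead_coef] carries this equality
    to all of S. Equality is rigid: every f in S is conjugate to X^d ([rigidity_monic]), with the
    conjugated Julia set in the closed unit disc ([pure_power_bound]). Hence f moves points of J(S)
    by at most 2 rho. The conjugation depends on f but this bound does not, so the orbit of z0 is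
    bounded, a contradiction. A finite J(S) would be mapped into itself
    ([finite_backward_invariant_forward]), which bounds the orbit as well. *)

Lemma cabsM (R : realType) (x y : R[i]) : cabs (x * y) = cabs x * cabs y.
Proof. exact: Normc.normcM. Qed.

Lemma cabsD (R : realType) (x y : R[i]) : cabs (x + y) <= cabs x + cabs y.
Proof. exact: le_normcD. Qed.

Lemma cabsN (R : realType) (x : R[i]) : cabs (- x) = cabs x.
Proof. exact: normcN. Qed.

Lemma cabsC (R : realType) (x y : R[i]) : cabs (x - y) = cabs (y - x).
Proof. by rewrite -opprB cabsN. Qed.

Lemma cabs0 (R : realType) : cabs (0 : R[i]) = 0.
Proof. exact: Normc.normc0. Qed.

Lemma cabs1 (R : realType) : cabs (1 : R[i]) = 1.
Proof. exact: Normc.normc1. Qed.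

Lemma cabs_ge0 (R : realType) (x : R[i]) : 0 <= cabs x.
Proof. by case: x => a b; exact: sqrtr_ge0. Qed.

Lemma cabs_eq0 (R : realType) (x : R[i]) : (cabs x == 0) = (x == 0).
Proof. by apply/eqP/eqP => [/Normc.eq0_normc|->] //; exact: cabs0. Qed.

Lemma cabs_gt0 (R : realType) (x : R[i]) : (0 < cabs x) = (x != 0).
Proof. by rewrite lt0r cabs_eq0 cabs_ge0 andbT. Qed.

Lemma cabsX (R : realType) (x : R[i]) n : cabs (x ^+ n) = cabs x ^+ n.
Proof. by elim: n => [|n IH]; rewrite ?cabs1// !exprS cabsM IH. Qed.

Lemma cabsV (R : realType) (x : R[i]) : cabs x^-1 = (cabs x)^-1.
Proof. exact: Normc.normcV. Qed.

Lemma cabs_nat (R : realType) n : cabs (n%:R : R[i]) = n%:R.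
Proof.
by rewrite /cabs normcMn [X in X *+ n]Normc.normc1.
Qed.

Lemma cabs_prod (R : realType) (I : Type) (r : seq I) (P : pred I)
    (F : I -> R[i]) :
  cabs (\prod_(i <- r | P i) F i) = \prod_(i <- r | P i) cabs (F i).
Proof. exact: (big_morph _ (@cabsM R) (@cabs1 R)). Qed.

Lemma cabs_sum (R : realType) (I : Type) (r : seq I) (P : pred I)
    (F : I -> R[i]) :
  cabs (\sum_(i <- r | P i) F i) <= \sum_(i <- r | P i) cabs (F i).
Proof.
elim/big_ind2: _ => [||//]; first by rewrite cabs0.
by move=> x1 x2 y1 y2 h1 h2; apply: le_trans (cabsD _ _) (lerD h1 h2).
Qed.

Lemma cabsB_ge (R : realType) (x y : R[i]) : cabs x - cabs y <= cabs (x - y).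
Proof. by rewrite lerBlDr; apply: le_trans (cabsD _ _); rewrite subrK. Qed.

Lemma cabs_sqrE (R : realType) (x : R[i]) :
  cabs x ^+ 2 = complex.Re x ^+ 2 + complex.Im x ^+ 2.
Proof. by case: x => a b; rewrite /cabs /= sqr_sqrtr // addr_ge0 ?sqr_ge0. Qed.

Lemma cabs_parallelogram (R : realType) (x y : R[i]) :
  cabs (x + y) ^+ 2 + cabs (x - y) ^+ 2 = 2 * (cabs x ^+ 2 + cabs y ^+ 2).
Proof. by rewrite !cabs_sqrE; case: x y => [a b] [c d] /=; ring. Qed.

Lemma cabs_triangle (R : realType) (x y z : R[i]) :
  cabs (x - z) <= cabs (x - y) + cabs (y - z).
Proof. by apply: le_trans (cabsD _ _); rewrite addrA subrK. Qed.

Lemma bernoulli (R : realFieldType) (u : R) (n : nat) :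
  -1 <= u -> 1 + n%:R * u <= (1 + u) ^+ n.
Proof.
move=> u1; elim: n => [|n IH]; first by rewrite mul0r addr0 expr0.
rewrite exprS; apply: le_trans (ler_wpM2l _ IH); last by lra.
have := mulr_ge0 (ler0n R n) (sqr_ge0 u); rewrite -natr1; nra.
Qed.

(* Bernoulli applied twice: the ratio of exponentials grows at least          *)
(* quadratically in the exponent.                                             *)
Lemma expr_quadratic_growth (R : realType) (a b : R) :
  0 <= b -> b < a ->
  exists2 h : R, 0 < h & forall n : nat, h * n%:R ^+ 2 * b ^+ n <= a ^+ n.
Proof.
move=> b0 ba; have a0 : 0 < a by exact: le_lt_trans ba.
have [->|b_neq0] := eqVneq b 0.
  exists 1 => // -[|k]; first by rewrite expr0n /= !mulr0 mul0r exprn_ge0 ?ltW.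
  by rewrite expr0n /= mulr0 exprn_ge0 ?ltW.
have bp : 0 < b by rewrite lt0r b_neq0.
pose c := (a + b) / 2.
have [cb ac] : b < c /\ c < a by rewrite /c; split; lra.
have cp : 0 < c by lra.
pose u := c / b - 1; pose v := a / c - 1.
have up : 0 < u by rewrite subr_gt0 ltr_pdivlMr // mul1r.
have vp : 0 < v by rewrite subr_gt0 ltr_pdivlMr // mul1r.
exists (u * v) => [|k]; first exact: mulr_gt0.
have -> : a = (1 + u) * (1 + v) * b.
  rewrite /u /v; field; lra.
rewrite !exprMn ler_wpM2r ?exprn_ge0 //.
have h1 : 1 + k%:R * u <= (1 + u) ^+ k by apply: bernoulli; lra.
have h2 : 1 + k%:R * v <= (1 + v) ^+ k by apply: bernoulli; lra.
have k0 := ler0n R k.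
have -> : u * v * k%:R ^+ 2 = (k%:R * u) * (k%:R * v) by ring.
by apply: ler_pM; [exact: mulr_ge0 (ltW _)|exact: mulr_ge0 (ltW _)|lra|lra].
Qed.

(** A factor linear in the exponent cannot make up for an exponential gap, because the quadratic
    growth of the ratio overtakes it. This removes such losses from inequalities between high
    powers; [n < D n] makes the exponents positive and unbounded. *)
Lemma le_of_expr_growth (R : realType) (a b al be : R) (D : nat -> nat) :
  0 <= a -> 0 <= b -> (forall n, (n < D n)%N) ->
  (forall n, a ^+ D n <= (al * (D n)%:R + be) * b ^+ D n) -> a <= b.
Proof.
move=> a0 b0 Dn H; rewrite leNgt; apply/negP => ba.
have [h hp Hh] := expr_quadratic_growth b0 ba.
have [bz|bp] : b = 0 \/ 0 < b.
- by rewrite lt0r b0 andbT; case: eqVneq => [->|_]; [left|right].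
- have := H 0; rewrite bz expr0n gtn_eqF ?(leq_trans _ (Dn 0%N))// mulr0.
  by rewrite leNgt exprn_gt0 // -bz.
pose C := (`|al| + `|be|) / h.
have C0 : 0 <= C by rewrite divr_ge0 ?addr_ge0 // ltW.
pose n := Num.bound C; have nC : C < n%:R.
  by have := archi_boundP C0.
have {nC} DC : C < (D n)%:R by apply: lt_trans nC _; rewrite ltr_nat.
have D1 : 1 <= (D n)%:R :> R by rewrite ler1n; apply: leq_trans (Dn n).
have := le_trans (Hh (D n)) (H n).
rewrite ler_pM2r ?exprn_gt0 // leNgt => /negP; apply.
have : `|al| + `|be| < (D n)%:R * h by rewrite -ltr_pdivrMr.
have := ler_norm al; have := ler_norm be; have := normr_ge0 be.
set x := (D n)%:R; move=> e1 e2 e3 e4.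
have : al * x + be <= (`|al| + `|be|) * x by nra.
nra.
Qed.

(** * Power sums of the roots of g - w *)

(* Newton's recursion for the power sums of the roots of [g - w], viewed as    *)
(* polynomials in [w]: for [n] at least the degree the term [g`_0 - w]        *)
(* contributes the factor 'X.                                                 *)
Definition psum_step (F : fieldType) (g : {poly F}) (p : nat -> {poly F})
    (n : nat) : {poly F} :=
  let d := (size g).-1 in
  (if (n < d)%N then ((d - n)%:R * g`_(d - n))%:P else 'X * p (n - d)%N)
  - \sum_(l < d | (d <= n + l)%N) g`_l *: p (n + l - d)%N.

(** The recursion reaches back as far as the degree of [g], so the list of all earlier values is
    carried along. *)
Fixpoint psum_seq (F : fieldType) (g : {poly F}) (n : nat) : seq {poly F} :=
  if n is n'.+1 then
    let s := psum_seq g n' in rcons s (psum_step g (fun i => s`_i) n')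
  else [::].

Definition psum (F : fieldType) (g : {poly F}) (n : nat) : {poly F} :=
  (psum_seq g n.+1)`_n.

Lemma size_psum_seq (F : fieldType) (g : {poly F}) n :
  size (psum_seq g n) = n.
Proof. by elim: n => //= n IH; rewrite size_rcons IH. Qed.

Lemma nth_psum_seq (F : fieldType) (g : {poly F}) n i :
  (i < n)%N -> (psum_seq g n)`_i = psum g i.
Proof.
elim: n => // n IH; rewrite ltnS leq_eqVlt => /orP[/eqP->//|iltn].
by rewrite /= nth_rcons size_psum_seq iltn IH.
Qed.

Lemma psumE (F : fieldType) (g : {poly F}) n :
  (1 < size g)%N -> psum g n = psum_step g (psum g) n.
Proof.
move=> g1; rewrite /psum /= nth_rcons size_psum_seq ltnn eqxx /psum_step.
congr (_ - _).
  case: ltnP => // dn; congr (_ * _).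
  by apply: nth_psum_seq; rewrite ltn_subrL; case: n dn; case: (size g) g1 => [|[]].
apply: eq_bigr => l dnl; congr (_ *: _); apply: nth_psum_seq.
by have := ltn_ord l; lia.
Qed.

Lemma deriv_prod_XsubC (F : fieldType) (rs : seq F) :
  (\prod_(x <- rs) ('X - x%:P))^`() =
  \sum_(x <- rs) (\prod_(y <- rs) ('X - y%:P)) %/ ('X - x%:P).
Proof.
elim: rs => [|y rs IH]; first by rewrite !big_nil derivC.
rewrite !big_cons derivM IH derivXsubC mul1r mulKp ?polyXsubC_eq0 //.
congr (_ + _); rewrite mulr_sumr; apply: eq_big_seq => x xrs.
by rewrite divp_mulA // dvdp_XsubCl root_prod_XsubC.
Qed.

(** Since [h] vanishes at [x], it is the sum of the h_l (X^l - x^l), and each X^l - x^l is X - x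
    times a geometric sum. *)
Lemma divp_XsubC_root (F : fieldType) (h : {poly F}) (x : F) (a : nat) :
  root h x -> (h %/ ('X - x%:P))`_a =
  \sum_(l < size h | (a < l)%N) h`_l * x ^+ (l.-1 - a).
Proof.
move=> /rootP hx.
have -> : h %/ ('X - x%:P) =
    \sum_(l < size h) h`_l *: \sum_(i < l) 'X^(l.-1 - i) * (x%:P) ^+ i.
  apply: (mulIf (negbT (polyXsubC_eq0 x))).
  rewrite divpK ?dvdp_XsubCl; last by apply/rootP.
  transitivity (h - h.[x]%:P); first by rewrite hx subr0.
  rewrite -{1}[h]coefK poly_def horner_coef rmorph_sum /= -sumrB mulr_suml.
  apply: eq_bigr => l _; rewrite -scalerAl.
  rewrite (_ : _ * ('X - x%:P) = 'X^l - x%:P ^+ l); last by rewrite subrXX mulrC.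
  by rewrite scalerBr rmorphM rmorphXn /= mul_polyC.
rewrite coef_sum [RHS]big_mkcond /=; apply: eq_bigr => l _.
rewrite coefZ coef_sum; case: ltnP => [al|la].
  have lt : (l.-1 - a < l)%N by lia.
  rewrite (bigD1 (Ordinal lt)) //= -rmorphXn coefMC coefXn.
  rewrite (_ : (a == _) = true) ?mul1r; last by lia.
  rewrite big1 ?addr0 // => i inl.
  rewrite -rmorphXn coefMC coefXn; case: eqP => [ai|]; last by rewrite mul0r.
  by case/eqP: inl; apply: val_inj => /=; have := ltn_ord i; lia.
rewrite big1 ?mulr0 // => i _; rewrite -rmorphXn coefMC coefXn.
by case: eqP => [ai|]; rewrite ?mul0r //; have := ltn_ord i; lia.
Qed.

(** Newton's identities. For i >= d, the equation g(x) = w times x^(i-d) is summed over the roots;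
    for i < d, coefficients are compared in the expression of (g - w)' = g' as the sum of the (g -
    w) / (X - x). *)
Lemma psum_roots (F : fieldType) (g : {poly F}) (w : F) (rs : seq F) (i : nat) :
  g \is monic -> (1 < size g)%N ->
  g - w%:P = \prod_(x <- rs) ('X - x%:P) ->
  \sum_(x <- rs) x ^+ i = (psum g i).[w].
Proof.
move=> gm g1 E; have [d sg] : exists d, size g = d.+2.
  by case: (size g) g1 => [|[|d]] // _; exists d.
have gd : g`_d.+1 = 1 by move/monicP: gm; rewrite /lead_coef sg.
have gx x : x \in rs -> g.[x] = w.
  move=> xrs; apply/eqP; rewrite -subr_eq0 -[w in _ - w](hornerC w x) -hornerN.
  by rewrite -hornerD E -rootE root_prod_XsubC.
elim/ltn_ind: i => i IH; rewrite psumE // /psum_step sg /= hornerD hornerN.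
rewrite horner_sum; apply/eqP; rewrite eq_sym subr_eq; apply/eqP.
have step l : (l < d.+1)%N -> (d.+1 <= i + l)%N ->
    (g`_l *: psum g (i + l - d.+1)).[w] = g`_l * \sum_(x <- rs) x ^+ (i + l - d.+1).
  by move=> ld dil; rewrite hornerZ -IH //; lia.
rewrite (eq_bigr (fun l : 'I_d.+1 => g`_l * \sum_(x <- rs) x ^+ (i + l - d.+1)));
  last by move=> l dil; apply: step.
case: ltnP => [id|di]; last first.
  rewrite hornerM hornerX -IH; last by lia.
  rewrite mulr_sumr (eq_big_seq (fun x => \sum_(l < d.+2) g`_l * x ^+ (i + l - d.+1))).
    rewrite exchange_big /= big_ord_recr /= gd addrC; congr (_ + _).
      by apply: eq_bigr => x _; rewrite mul1r addnK.
    rewrite [RHS]big_mkcond /=; apply: eq_bigr => l _.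
    by rewrite (leq_trans di (leq_addr _ _)) mulr_sumr.
  move=> x xrs; rewrite -{1}(gx _ xrs) horner_coef sg mulr_suml.
  apply: eq_bigr => l _; rewrite -mulrA -exprD; congr (_ * x ^+ _); lia.
have /(congr1 (fun p : {poly F} => p`_(d - i))) : (g - w%:P)^`() = g^`().
  by rewrite derivB derivC subr0.
rewrite E deriv_prod_XsubC coef_deriv coef_sum -E => H.
rewrite hornerC; have -> : (d.+1 - i)%N = (d - i).+1 by lia.
rewrite mulr_natl -H.
have sz : size (g - w%:P) = d.+2.
  rewrite size_polyDl ?sg // size_polyN; exact: leq_ltn_trans (size_polyC_leq1 _) _.
have co l : (d - i < l)%N -> (g - w%:P)`_l = g`_l.
  by move=> dl; rewrite coefB coefC gtn_eqF ?subr0 //; apply: leq_trans dl.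
rewrite (eq_big_seq (fun x => \sum_(l < d.+2 | (d - i < l)%N) g`_l * x ^+ (i + l - d.+1))).
  rewrite exchange_big /= [LHS]big_mkcond big_ord_recr /= -big_mkcond /=.
  rewrite ltnS leq_subr gd addrC; congr (_ + _).
    by apply: eq_bigr => x _; rewrite mul1r addnK.
  apply: eq_big => [l|l dil]; last by rewrite mulr_sumr.
  by have := ltn_ord l; lia.
move=> x xrs; rewrite divp_XsubC_root; last by rewrite E root_prod_XsubC.
rewrite sz; apply: eq_bigr => l dl; rewrite co //; congr (_ * x ^+ _).
by have := ltn_ord l; lia.
Qed.

(** If x has weight 1, then w = g(x) has weight d, and the recursion respects weights. *)
Lemma size_psum (F : fieldType) (g : {poly F}) (i : nat) :
  (1 < size g)%N -> (size (psum g i) <= (i %/ (size g).-1).+1)%N.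
Proof.
move=> g1; elim/ltn_ind: i => i IH; rewrite psumE // /psum_step.
set d := (size g).-1 in IH *; have d0 : (0 < d)%N by rewrite /d; lia.
apply: leq_trans (size_polyD _ _) _; rewrite geq_max size_polyN; apply/andP; split.
  case: ltnP => [id|di]; first exact: leq_trans (size_polyC_leq1 _) _.
  apply: leq_trans (size_polyMleq _ _) _; rewrite size_polyX /=.
  have := congr1 (divn^~ d) (subnK di); rewrite divnDr // divnn d0 => <-.
  have {IH} := IH (i - d)%N; set q := (_ %/ _)%N; set s := size _.
  by lia.
apply: (leq_trans (size_sum _ _ _)); apply/bigmax_leqP => l dil.
apply: leq_trans (size_scale_leq _ _) _.
apply: leq_trans (IH _ _) _; first by have := ltn_ord l; lia.
by rewrite ltnS leq_div2r //; have := ltn_ord l; lia.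
Qed.

Lemma coef_psum_mul (F : fieldType) (g : {poly F}) (m : nat) :
  g \is monic -> (1 < size g)%N ->
  (psum g ((size g).-1 * m))`_m = (size g).-1%:R.
Proof.
move=> gm g1; set d := (size g).-1; have d0 : (0 < d)%N by rewrite /d; lia.
have gd : g`_d = 1 by move/monicP: gm.
elim: m => [|m IH]; rewrite psumE // /psum_step -/d.
  rewrite muln0 d0 subn0 gd mulr1 coefB coefC /= big1 ?coef0 ?subr0 // => l.
  by have := ltn_ord l; rewrite add0n; lia.
rewrite ltnNge leq_pmulr //= mulnS addKn coefB coefXM /= IH coef_sum.
rewrite big1 ?subr0 // => l _; rewrite coefZ [X in _ * X]nth_default ?mulr0 //.
apply: leq_trans (size_psum _ _) _ => //; rewrite -/d.
by rewrite -addnA addKn mulnC divnMDl // divn_small ?addn0.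
Qed.

(** Here [r] is the gap below the leading term. A step from m to m + 1 keeps the previous value
    through the term ['X * p (n - d)] and, when e = r, adds -d g_(d-r) through the term l = d - r.
    The resulting growth in m is what the equality case exploits. *)
Lemma coef_psum_subleading (F : fieldType) (g : {poly F}) (r m e : nat) :
  g \is monic -> (r < (size g).-1)%N ->
  (forall l, ((size g).-1 - r < l < (size g).-1)%N -> g`_l = 0) ->
  (0 < e <= r)%N ->
  (psum g ((size g).-1 * m + e))`_m =
    if (e == r)%N then - (((size g).-1 * m + r)%:R * g`_((size g).-1 - r))
    else 0.
Proof.
set d := (size g).-1 => gm rd g0 /andP[e0 er].
have g1 : (1 < size g)%N by move: rd; rewrite /d; lia.
have d0 : (0 < d)%N by lia.
elim: m => [|m IH]; rewrite psumE // /psum_step -/d.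
  rewrite muln0 !add0n ifT ?coefB ?coefC /=; last by lia.
  have [->|ne] := eqVneq e r.
    have rd' : (d - r < d)%N by lia.
    rewrite coef_sum (bigD1 (Ordinal rd')) /=; last by lia.
    have -> : (r + (d - r) - d = 0)%N by lia.
    rewrite big1 ?addr0 => [|l /andP[dl ln]].
      have := @coef_psum_mul _ g 0 gm g1; rewrite muln0 => p0.
      rewrite coefZ p0 -/d natrB; last by lia.
      ring.
    rewrite coefZ g0 ?mul0r //; have := ltn_ord l.
    by move: ln; rewrite -val_eqE /=; lia.
  rewrite g0 ?mulr0; last by lia.
  rewrite big1 ?coef0 ?subr0 // => l dl.
  by rewrite g0 ?scale0r //; have := ltn_ord l; lia.
have -> : (d * m.+1 + e < d)%N = false by rewrite mulnS; lia.
have -> : (d * m.+1 + e - d = d * m + e)%N by rewrite mulnS; lia.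
rewrite coefB coefXM /= IH coef_sum.
have small l : (l < d)%N -> (e + l < d)%N -> (psum g (d * m.+1 + e + l - d))`_m.+1 = 0.
  move=> ld eld; rewrite nth_default //; apply: leq_trans (size_psum _ _) _ => //.
  rewrite -/d (_ : (_ - _ = m * d + (e + l))%N); last by rewrite mulnS; lia.
  by rewrite divnMDl // divn_small ?addn0.
have [er'|ne] := eqVneq e r.
  subst r; have rd' : (d - e < d)%N by lia.
  rewrite (bigD1 (Ordinal rd')) /=; last by rewrite mulnS; lia.
  rewrite big1 ?addr0 => [|l /andP[dl ln]]; last first.
    rewrite coefZ; have [eld|eld] := ltnP (e + l) d; first by rewrite small ?mulr0.
    rewrite g0 ?mul0r //; have := ltn_ord l.
    by move: ln; rewrite -val_eqE /=; lia.
  rewrite coefZ (_ : (_ + _ - d = d * m.+1)%N); last by rewrite mulnS; lia.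
  by rewrite coef_psum_mul // -/d mulnS -addnA (natrD _ d); ring.
rewrite big1 ?subr0 // => l dl; rewrite coefZ.
have [eld|eld] := ltnP (e + l) d; first by rewrite small ?mulr0.
by rewrite g0 ?mul0r //; have := ltn_ord l; lia.
Qed.

(** * Leading forms and moment functionals *)

Definition total_degree_le (F : nzRingType) (m : nat) (P : {poly {poly F}}) :=
  forall a b, (m < a + b)%N -> P`_a`_b = 0.

(* The coefficients of total degree [m], i.e. the leading form at [(t, 1)].   *)
Definition top_form (F : nzRingType) (m : nat) (P : {poly {poly F}}) :
    {poly F} :=
  \poly_(a < m.+1) P`_a`_(m - a).

Lemma total_degree_leM (F : nzRingType) (m n : nat) (P Q : {poly {poly F}}) :
  total_degree_le m P -> total_degree_le n Q -> total_degree_le (m + n) (P * Q).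
Proof.
move=> hP hQ a b ab; rewrite coefM coef_sum big1 // => i _.
rewrite coefM big1 // => j _; have := ltn_ord i; have := ltn_ord j.
have [hij|hij] := ltnP m (i + j); first by rewrite hP ?mul0r.
by move=> ? ?; rewrite hQ ?mulr0 //; lia.
Qed.

Lemma top_formM (F : nzRingType) (m n : nat) (P Q : {poly {poly F}}) :
  total_degree_le m P -> total_degree_le n Q ->
  top_form (m + n) (P * Q) = top_form m P * top_form n Q.
Proof.
move=> hP hQ; apply/polyP => a; rewrite coef_poly coefM.
case: ltnP => [amn|amn]; last first.
  rewrite big1 // => i _; rewrite !coef_poly; have ia := ltn_ord i.
  case: ltnP => [im|]; last by rewrite mul0r.
  by case: ltnP => [|]; [lia|rewrite mulr0].
rewrite coefM coef_sum; apply: eq_bigr => i _; have ia := ltn_ord i.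
rewrite !coef_poly coefM; case: ltnP => [im|im]; last first.
  by rewrite mul0r big1 // => j _; rewrite hP ?mul0r //; lia.
case: ltnP => [an|an]; last first.
  rewrite mulr0 big1 // => j _; have jl := ltn_ord j.
  have [hij|hij] := ltnP m (i + j); first by rewrite hP ?mul0r.
  by rewrite hQ ?mulr0 //; lia.
have lt : (m - i < (m + n - a).+1)%N by lia.
rewrite (bigD1 (Ordinal lt)) //= big1 ?addr0 => [|j jn].
  by congr (_ * Q`_ _`_ _); lia.
have jl := ltn_ord j; have {}jn : (nat_of_ord j != m - i)%N by move: jn; rewrite -val_eqE.
have [hij|hij] := ltnP m (i + j); first by rewrite hP ?mul0r.
by rewrite hQ ?mulr0 //; lia.
Qed.

Lemma total_degree_leX (F : nzRingType) (m k : nat) (P : {poly {poly F}}) :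
  total_degree_le m P -> total_degree_le (m * k) (P ^+ k).
Proof.
move=> hP; elim: k => [|k IH]; last by rewrite exprS mulnS; exact: total_degree_leM.
move=> a b; rewrite muln0 expr0 coef1; case: a => [|a]; rewrite ?coef0 //.
by rewrite add0n coef1 /=; case: b.
Qed.

Lemma top_formX (F : nzRingType) (m k : nat) (P : {poly {poly F}}) :
  total_degree_le m P -> top_form (m * k) (P ^+ k) = top_form m P ^+ k.
Proof.
move=> hP; elim: k => [|k IH]; last first.
  by rewrite !exprS mulnS top_formM ?IH //; exact: total_degree_leX.
rewrite !expr0 muln0; apply/polyP => -[|a]; rewrite coef_poly !coef1 //=.
Qed.

Lemma horner2_total_degree (F : comNzRingType) (m : nat) (P : {poly {poly F}})
    (x y : F) :
  total_degree_le m P ->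
  P.[x%:P].[y] = \sum_(a < m.+1) \sum_(b < m.+1) P`_a`_b * x ^+ a * y ^+ b.
Proof.
move=> hP; rewrite (@horner_coef_wide _ m.+1 P); last first.
  apply/leq_sizeP => a ma; apply/polyP => b; rewrite coef0 hP //; lia.
rewrite horner_sum; apply: eq_bigr => a _.
rewrite -rmorphXn hornerM hornerC (@horner_coef_wide _ m.+1); last first.
  by apply/leq_sizeP => b mb; rewrite hP //; lia.
by rewrite mulr_suml; apply: eq_bigr => b _; rewrite mulrAC.
Qed.

(** * Fibres with multiplicity, and functionals supported on E *)

Definition roots_of (F : closedFieldType) (g : {poly F}) (w : F) : seq F :=
  sval (closed_field_poly_normal (g - w%:P)).

Lemma lead_coef_subC (F : nzRingType) (g : {poly F}) (w : F) :
  (1 < size g)%N -> lead_coef (g - w%:P) = lead_coef g.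
Proof.
move=> g1; apply: lead_coefDl; rewrite size_polyN.
exact: leq_ltn_trans (size_polyC_leq1 _) _.
Qed.

Lemma roots_ofE (F : closedFieldType) (g : {poly F}) (w : F) :
  (1 < size g)%N ->
  g - w%:P = lead_coef g *: \prod_(x <- roots_of g w) ('X - x%:P).
Proof.
move=> g1; rewrite /roots_of; case: closed_field_poly_normal => rs /= ->.
by rewrite -[X in _ = X *: _](lead_coef_subC w g1) -?lead_coef_subC.
Qed.

Lemma size_roots_of (F : closedFieldType) (g : {poly F}) (w : F) :
  (1 < size g)%N -> size (roots_of g w) = (size g).-1.
Proof.
move=> g1; have := congr1 (fun p : {poly F} => size p) (roots_ofE w g1).
have lg : lead_coef g != 0 by rewrite lead_coef_eq0 -size_poly_gt0; lia.
rewrite size_scale // size_prod_XsubC size_polyDl => [->//|].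
by rewrite size_polyN; exact: leq_ltn_trans (size_polyC_leq1 _) _.
Qed.

Lemma mem_roots_of (F : closedFieldType) (g : {poly F}) (w x : F) :
  (1 < size g)%N -> (x \in roots_of g w) = (g.[x] == w).
Proof.
move=> g1; rewrite -root_prod_XsubC.
have lg : lead_coef g != 0 by rewrite lead_coef_eq0 -size_poly_gt0; lia.
by rewrite -(rootZ _ _ lg) -roots_ofE // rootE hornerD hornerN hornerC subr_eq0.
Qed.

Lemma psum_roots_of (F : closedFieldType) (g : {poly F}) (w : F) (i : nat) :
  g \is monic -> (1 < size g)%N ->
  \sum_(x <- roots_of g w) x ^+ i = (psum g i).[w].
Proof.
move=> gm g1; apply: psum_roots => //.
by rewrite roots_ofE // (monicP gm) scale1r.
Qed.

Definition infinite_pred (T : eqType) (E : T -> Prop) : Prop :=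
  ~ exists s : seq T, forall z, E z -> z \in s.

Lemma infinite_pred_uniq (T : eqType) (E : T -> Prop) (n : nat) :
  infinite_pred E ->
  exists s : seq T, [/\ uniq s, size s = n & forall z, z \in s -> E z].
Proof.
move=> hE; elim: n => [|n [s [us <- sE]]]; first by exists [::].
have [z [Ez zs]] : exists z, E z /\ z \notin s.
  apply: contrapT => H; apply: hE; exists s => z Ez.
  by apply: contrapT => zs; apply: H; exists z; split=> //; apply/negP.
by exists (z :: s); split; rewrite /= ?zs // => y; rewrite inE => /predU1P[->|/sE].
Qed.

(** A divided difference at s + 1 distinct points of E: the Vandermonde matrix is invertible, so
    weights picking out the coefficient of degree s exist. *)
Lemma leading_coef_functional (F : fieldType) (E : F -> Prop) (s : nat) :
  infinite_pred E ->
  exists cs : seq (F * F), (forall p, p \in cs -> E p.2) /\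
    forall q : {poly F}, (size q <= s.+1)%N ->
      \sum_(p <- cs) p.1 * q.[p.2] = q`_s.
Proof.
move=> hE; have [ws [uws sws wsE]] := infinite_pred_uniq s.+1 hE.
pose a : 'rV[F]_s.+1 := \row_i ws`_i.
pose V := Vandermonde s.+1 a.
have Vu : V \in unitmx.
  rewrite unitmxE det_Vandermonde unitfE; apply/prodf_neq0 => i _.
  apply/prodf_neq0 => j ij; rewrite !mxE subr_eq0 nth_uniq ?sws ?ltn_ord //.
  by rewrite gtn_eqF.
pose l := invmx V *m \col_i (i == s :> nat)%:R.
have Vl : V *m l = \col_i (i == s :> nat)%:R by rewrite mulmxA mulmxV ?mul1mx.
exists [seq (l i 0, ws`_i) | i <- enum 'I_s.+1]; split.
  by move=> p /mapP[i _ ->] /=; apply: wsE; rewrite mem_nth // sws ltn_ord.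
move=> q sq; rewrite big_map big_enum /=.
under eq_bigr => i _ do rewrite (horner_coef_wide _ sq) mulr_sumr.
rewrite exchange_big /= (eq_bigr (fun k : 'I_s.+1 => q`_k * (k == s :> nat)%:R)).
  rewrite (bigD1 ord_max) //= eqxx mulr1 big1 ?addr0 // => k ks.
  by rewrite -val_eqE in ks; rewrite (negbTE ks) mulr0.
move=> k _; have /matrixP/(_ k 0) := Vl; rewrite !mxE => <-.
by rewrite mulr_sumr; apply: eq_bigr => i _; rewrite !mxE; ring.
Qed.

(* Averaging a functional on [E] over the fibres of [G] multiplies its order  *)
(* by the degree of [G] without increasing its norm.                          *)
Lemma moment_functional (R : realType) (E : R[i] -> Prop) (s : nat) :
  infinite_pred E ->
  exists Lam : R, 0 <= Lam /\
    forall G : {poly R[i]}, G \is monic -> (1 < size G)%N ->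
    (forall z, E G.[z] -> E z) ->
    exists cs : seq (R[i] * R[i]),
      [/\ forall p, p \in cs -> E p.2,
          \sum_(p <- cs) cabs p.1 <= Lam
        & forall a, (a <= (size G).-1 * s)%N ->
            \sum_(p <- cs) p.1 * p.2 ^+ a = (a == (size G).-1 * s)%:R].
Proof.
move=> hE; have [cs [csE csf]] := leading_coef_functional s hE.
exists (\sum_(p <- cs) cabs p.1); split.
  by apply: sumr_ge0 => p _; exact: cabs_ge0.
move=> G Gm G1 invG; set D := (size G).-1; have D0 : (0 < D)%N by rewrite /D; lia.
have Dn0 : D%:R != 0 :> R[i] by rewrite pnatr_eq0 -lt0n.
(* Each node is replaced by its D preimages under G, with its weight divided by D; a moment of order
   a then becomes the old functional at a polynomial of degree at most a / D. *)
exists (flatten [seq [seq (p.1 / D%:R, x) | x <- roots_of G p.2] | p <- cs]); split.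
- move=> p /flattenP[s' /mapP[p' /csE Ep' ->] /mapP[x xr ->]] /=.
  by apply: invG; move: xr; rewrite mem_roots_of // => /eqP ->.
- rewrite big_flatten big_map; apply: ler_sum => p _; rewrite big_map /=.
  rewrite big_const_seq iter_addr_0 count_predT size_roots_of // -/D cabsM cabsV.
  by rewrite cabs_nat -(mulr_natr (_ / _)) mulfVK // pnatr_eq0 -lt0n.
move=> a aDs; rewrite big_flatten big_map.
rewrite (eq_bigr (fun p => p.1 * (D%:R^-1 *: psum G a).[p.2])); last first.
  move=> p _; rewrite big_map /= -mulr_sumr psum_roots_of // hornerZ; ring.
have sa : (size (psum G a) <= (a %/ D).+1)%N by exact: size_psum.
have as' : (a %/ D <= s)%N by rewrite -(mulKn s D0) leq_div2r.
rewrite csf; last by apply: leq_trans (size_scale_leq _ _) (leq_trans sa _).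
rewrite coefZ; case: eqP => [->|/eqP ne]; first by rewrite coef_psum_mul // mulVf.
rewrite nth_default ?mulr0 //; apply: leq_trans sa _.
by rewrite ltn_divLR //; lia.
Qed.

Definition iter_poly (F : nzRingType) (g : {poly F}) (n : nat) : {poly F} :=
  iter n (fun h => g \Po h) 'X.

Lemma comp_monic (F : idomainType) (p q : {poly F}) :
  p \is monic -> q \is monic -> (1 < size q)%N -> p \Po q \is monic.
Proof.
move=> /monicP pm /monicP qm q1; apply/monicP.
by rewrite lead_coef_comp // pm qm expr1n mulr1.
Qed.

Lemma iter_polyP (F : idomainType) (g : {poly F}) (n : nat) :
  g \is monic -> (1 < size g)%N ->
  iter_poly g n \is monic /\ size (iter_poly g n) = ((size g).-1 ^ n).+1.
Proof.
move=> gm g1; elim: n => [|n [IHm IHs]] /=; first by rewrite monicX size_polyX.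
have d0 : (0 < (size g).-1 ^ n)%N by rewrite expn_gt0; lia.
split; first by apply: comp_monic; rewrite ?IHs.
have : (size (iter_poly g n.+1)).-1 = ((size g).-1 ^ n.+1)%N.
  by rewrite size_comp_poly IHs expnS.
have : (0 < (size g).-1 ^ n.+1)%N by rewrite expn_gt0; lia.
by case: (size _) => [|k] /=; lia.
Qed.

Lemma iter_poly_backward (F : comNzRingType) (E : F -> Prop) (g : {poly F}) n z :
  (forall z, E g.[z] -> E z) -> E (iter_poly g n).[z] -> E z.
Proof.
move=> invg; elim: n => [|n IH] /=; first by rewrite hornerX.
by rewrite horner_comp => /invg.
Qed.

(** * The torus inequality *)

(* The coefficient of a monomial [x^i y^(n - i)] of [P] is the value of a      *)
(* product of two moment functionals on [x^l y^l' P], where [l, l' < D] make  *)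
(* both exponents divisible by the degree [D] of [G].                         *)
Lemma torus_bound_step (R : realType) (E : R[i] -> Prop) (B : R) (k : nat) :
  infinite_pred E -> 1 <= B -> (forall z, E z -> cabs z <= B) ->
  exists Lam : R, forall G : {poly R[i]}, G \is monic -> (1 < size G)%N ->
    (forall z, E G.[z] -> E z) ->
    forall (n : nat) (P : {poly {poly R[i]}}) (M : R) (t : R[i]),
    n = ((size G).-1 * k)%N ->
    total_degree_le n P -> cabs t = 1 ->
    (forall x y, E x -> E y -> cabs P.[x%:P].[y] <= M) ->
    cabs (top_form n P).[t] <= n.+1%:R * (Lam * (B ^+ 2) ^+ (size G).-1 * M).
Proof.
move=> hE B1 bE.
have /choice[Lam hLam] := fun s => moment_functional s hE.
have Lam0 s : 0 <= Lam s by have [] := hLam s.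
pose L := \sum_(s < k.+1) Lam s.
have L0 : 0 <= L by apply: sumr_ge0.
have leL s : (s <= k)%N -> Lam s <= L.
  move=> sk; rewrite /L (bigD1 (Ordinal (sk : (s < k.+1)%N))) //= lerDl.
  exact: sumr_ge0.
have B0 : 0 <= B by apply: le_trans B1.
exists (L * L) => G Gm G1 invG n P M t nE hP t1 hM.
set D := (size G).-1 in nE *; have D0 : (0 < D)%N by rewrite /D; lia.
have M0 : 0 <= M.
  have [s [_ ss /(_ s`_0)]] := infinite_pred_uniq 1 hE.
  rewrite mem_nth ?ss // => /(_ isT) E0.
  by apply: le_trans (hM _ _ E0 E0); exact: cabs_ge0.
suff coef_bound i : (i <= n)%N ->
    cabs P`_i`_(n - i) <= L * L * (B ^+ 2) ^+ D * M.
  rewrite horner_poly; apply: le_trans (cabs_sum _ _ _) _.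
  rewrite mulr_natl -[X in _ *+ X]card_ord -sumr_const; apply: ler_sum => i _.
  rewrite cabsM cabsX t1 expr1n mulr1; apply: coef_bound.
  by rewrite -ltnS ltn_ord.
move=> iN.
(* Rounding an exponent up to a multiple of D costs a factor x^l with l < D, of modulus at most B^D
   on E. *)
have ceil j : (j <= n)%N -> exists s l, [/\ (s <= k)%N, (l < D)%N & (j + l = D * s)%N].
  move=> jn; exists ((j + D.-1) %/ D)%N, (D * ((j + D.-1) %/ D) - j)%N.
  have := divn_eq (j + D.-1) D; have := ltn_pmod (j + D.-1) D0.
  set q := (_ %/ _)%N; set r := (_ %% _)%N => rD E1; rewrite mulnC in E1.
  split; [|lia|lia].
  rewrite -ltnS -(ltn_pmul2l D0) mulnS -nE; lia.
have [s [l [sk lD il]]] := ceil _ iN.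
have [s' [l' [sk' lD' il']]] := ceil _ (leq_subr i n).
have [cs [csE csL csm]] := (hLam s).2 G Gm G1 invG.
have [cs' [csE' csL' csm']] := (hLam s').2 G Gm G1 invG.
rewrite -/D in csm csm'.
(* Any other monomial of total degree at most n has x-exponent below i or y-exponent below n - i, so
   one of the two functionals kills it. *)
have -> : P`_i`_(n - i) = \sum_(p <- cs) \sum_(p' <- cs')
    p.1 * p'.1 * (p.2 ^+ l * p'.2 ^+ l' * P.[p.2%:P].[p'.2]).
  under eq_bigr => p _ do under eq_bigr => p' _ do
    rewrite (horner2_total_degree _ _ hP) mulrA mulr_sumr.
  under eq_bigr => p _ do rewrite exchange_big /=.
  rewrite exchange_big /=.
  rewrite (eq_bigr (fun a : 'I_n.+1 => \sum_(b < n.+1) P`_a`_b *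
     ((\sum_(p <- cs) p.1 * p.2 ^+ (a + l)) *
      (\sum_(p' <- cs') p'.1 * p'.2 ^+ (b + l'))))); last first.
    move=> a _; transitivity (\sum_(b < n.+1) \sum_(p <- cs) \sum_(p' <- cs')
       P`_a`_b * ((p.1 * p.2 ^+ (a + l)) * (p'.1 * p'.2 ^+ (b + l')))).
      rewrite [RHS]exchange_big /=; apply: eq_bigr => p _.
      rewrite [RHS]exchange_big /=; apply: eq_bigr => p' _.
      rewrite mulr_sumr; apply: eq_bigr => b _; rewrite !exprD; ring.
    apply: eq_bigr => b _; rewrite big_distrlr mulr_sumr; apply: eq_bigr => p _.
    by rewrite mulr_sumr.
  have lt_i : (i < n.+1)%N by [].
  have lt_j : (n - i < n.+1)%N by lia.
  rewrite (bigD1 (Ordinal lt_i)) //= (bigD1 (Ordinal lt_j)) //=.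
  rewrite csm ?il // csm' ?il' // !eqxx !mulr1 !big1 ?addr0 // => [a an|b bn].
    rewrite big1 // => b _; have [|ab] := ltnP n (a + b); first by move/hP->; rewrite mul0r.
    have [ai|ia] := ltnP a i; first by rewrite csm ?ltn_eqF ?mul0r ?mulr0 //; lia.
    have {}an : (nat_of_ord a != i)%N by move: an; rewrite -val_eqE.
    by rewrite [X in _ * (_ * X)]csm' ?ltn_eqF ?mulr0 //; lia.
  have [|ab] := ltnP n (i + b); first by move/hP->; rewrite mul0r.
  have {}bn : (nat_of_ord b != n - i)%N by move: bn; rewrite -val_eqE.
  by rewrite csm' ?ltn_eqF ?mulr0 //; lia.
apply: le_trans (cabs_sum _ _ _) _.
apply: (@le_trans _ _ (\sum_(p <- cs) \sum_(p' <- cs')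
   cabs p.1 * cabs p'.1 * ((B ^+ 2) ^+ D * M))).
  rewrite big_seq [leRHS]big_seq; apply: ler_sum => p /csE Ep.
  apply: le_trans (cabs_sum _ _ _) _.
  rewrite big_seq [leRHS]big_seq; apply: ler_sum => p' /csE' Ep'.
  rewrite !cabsM ler_wpM2l ?mulr_ge0 ?cabs_ge0 // ler_pM ?mulr_ge0 ?cabs_ge0 ?hM //.
  rewrite -exprM mulnC mulnS muln1 exprD !cabsX.
  have le_pow z e : E z -> (e < D)%N -> cabs z ^+ e <= B ^+ D.
    move=> Ez eD; apply: (@le_trans _ _ (B ^+ e)).
      by rewrite lerXn2r ?nnegrE ?cabs_ge0 ?bE.
    by rewrite ler_weXn2l // ltnW.
  by rewrite ler_pM ?exprn_ge0 ?cabs_ge0 ?le_pow.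
rewrite (eq_bigr (fun p => cabs p.1 * ((\sum_(p' <- cs') cabs p'.1) *
   ((B ^+ 2) ^+ D * M)))) => [|p _]; last first.
  by rewrite mulr_suml mulr_sumr; apply: eq_bigr => p' _; rewrite !mulrA.
rewrite -mulr_suml -!mulrA; apply: ler_pM; rewrite ?mulr_ge0 ?exprn_ge0 //.
- by apply: sumr_ge0 => p _; exact: cabs_ge0.
- by apply: sumr_ge0 => p _; exact: cabs_ge0.
- exact: le_trans csL (leL _ sk).
apply: ler_wpM2r; rewrite ?mulr_ge0 ?exprn_ge0 //.
exact: le_trans csL' (leL _ sk').
Qed.

(* Apply the previous bound to [P ^+ (D * q)] and the iterates of [g], first   *)
(* with [D] tending to infinity, then [q].                                    *)
Lemma torus_bound (R : realType) (E : R[i] -> Prop) (B : R) (g : {poly R[i]})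
    (m : nat) (P : {poly {poly R[i]}}) (M : R) (t : R[i]) :
  infinite_pred E -> (forall z, E z -> cabs z <= B) ->
  g \is monic -> (2 < size g)%N -> (forall z, E g.[z] -> E z) ->
  total_degree_le m P -> cabs t = 1 ->
  (forall x y, E x -> E y -> cabs P.[x%:P].[y] <= M) ->
  cabs (top_form m P).[t] <= M.
Proof.
move=> hE bE gm g2 invg hP t1 hM; have g1 : (1 < size g)%N by exact: ltnW.
wlog B1 : B bE / 1 <= B.
  move=> H; apply: (H (Num.max 1 B)); rewrite ?le_max ?lexx // => z /bE zB.
  by rewrite le_max zB orbT.
have M0 : 0 <= M.
  have [s [_ ss /(_ s`_0)]] := infinite_pred_uniq 1 hE.
  rewrite mem_nth ?ss // => /(_ isT) E0.
  by apply: le_trans (hM _ _ E0 E0); exact: cabs_ge0.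
set X := cabs _; have X0 : 0 <= X by exact: cabs_ge0.
(* For fixed q, the growing degree of the iterate leaves X^(q+1) <= B^2 M^(q+1); letting q grow then
   removes B^2. *)
apply: (@le_of_expr_growth R X M 0 (B ^+ 2) succn) => // q.
have [Lam hLam] := torus_bound_step (m * q.+1) hE B1 bE.
rewrite mul0r add0r.
apply: (@le_of_expr_growth R _ _ ((m * q.+1)%:R * Lam) Lam
  (fun n => (size g).-1 ^ n)%N) => [|||n].
- exact: exprn_ge0.
- by rewrite mulr_ge0 ?exprn_ge0 // (le_trans _ B1).
- by move=> n; apply: ltn_expl; lia.
have [Gm sG] := iter_polyP n gm g1.
set D := ((size g).-1 ^ n)%N in sG *.
have D0 : (0 < D)%N by rewrite expn_gt0; lia.
have hM' x y : E x -> E y ->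
    cabs (P ^+ (D * q.+1)).[x%:P].[y] <= M ^+ (D * q.+1).
  by move=> Ex Ey; rewrite !horner_exp cabsX lerXn2r ?nnegrE ?cabs_ge0 ?hM.
have nE : (m * (D * q.+1) = (size (iter_poly g n)).-1 * (m * q.+1))%N.
  by rewrite sG mulnCA.
have G1 : (1 < size (iter_poly g n))%N by rewrite sG.
have := hLam _ Gm G1 (fun z => @iter_poly_backward _ E g n z invg) _ _ _ _ nE
  (@total_degree_leX _ m (D * q.+1)%N P hP) t1 hM'.
rewrite top_formX // horner_exp cabsX -/X sG /= -[X ^+ q.+1 ^+ D]exprM [(q.+1 * D)%N]mulnC.
move=> /le_trans; apply.
rewrite [in leRHS]exprMn -[M ^+ _ ^+ D]exprM [(q.+1 * D)%N]mulnC.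
set u := (B ^+ 2) ^+ D; set v := M ^+ _.
rewrite le_eqVlt; apply/orP; left; apply/eqP.
by rewrite -natr1 !natrM; ring.
Qed.

(** * Sums of powers of differences of roots *)

Lemma psum_Xn (F : fieldType) (d i : nat) (w : F) :
  (0 < d)%N ->
  (psum 'X^d i).[w] = if (d %| i)%N then d%:R * w ^+ (i %/ d) else 0.
Proof.
move=> d0; have g1 : (1 < size ('X^d : {poly F}))%N by rewrite size_polyXn; lia.
elim/ltn_ind: i => i IH; rewrite psumE // /psum_step size_polyXn /=.
rewrite big1 ?subr0 => [|l _]; last by rewrite coefXn ltn_eqF ?ltn_ord ?scale0r.
case: ltnP => [id|di].
  rewrite hornerC coefXn; have [->|i0] := posnP i.
    by rewrite dvdn0 subn0 eqxx div0n.
  by rewrite gtnNdvd // ltn_eqF ?mulr0 //; lia.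
rewrite hornerM hornerX IH; last by lia.
rewrite dvdn_subl ?dvdnn //; case: ifP => [/dvdnP[q iq]|_]; last by rewrite mulr0.
rewrite iq; case: q iq => [|q] iq; first by lia.
have -> : (q.+1 * d - d = q * d)%N by rewrite mulSn addKn.
by rewrite !mulnK // exprS; ring.
Qed.

(** For w = 1 this is the root-of-unity filter detecting divisibility by d. *)
Lemma sum_roots_of_Xn (F : closedFieldType) (d i : nat) (w : F) :
  (0 < d)%N ->
  \sum_(x <- roots_of 'X^d w) x ^+ i =
    if (d %| i)%N then d%:R * w ^+ (i %/ d) else 0.
Proof.
by move=> d0; rewrite psum_roots_of ?psum_Xn ?monicXn // size_polyXn; lia.
Qed.

(** The operator s d/ds applied to the expansion of (s - 1)^(k+1). *)
Lemma sum_binomial_weight_l (F : comNzRingType) (k : nat) (s : F) :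
  \sum_(i < k.+2) (-1) ^+ i * 'C(k.+1, i)%:R * ((k.+1 - i)%:R * s ^+ (k.+1 - i))
  = k.+1%:R * s * (s - 1) ^+ k.
Proof.
rewrite big_ord_recr /= subnn mul0r mulr0 addr0 exprBn mulr_sumr.
apply: eq_bigr => i _; have ik : (i <= k)%N by rewrite -ltnS ltn_ord.
rewrite expr1n mulr1 subSn // exprS -mulr_natr.
have /(congr1 (fun n => n%:R : F)) := mul_bin_down k.+1 i.
rewrite /= subSn // !natrM => e.
transitivity ((-1) ^+ i * s * s ^+ (k - i) * ((k - i).+1%:R * 'C(k.+1, i)%:R)).
  by ring.
by rewrite -e; ring.
Qed.

(** The derivative in y, at y = 1, of the expansion of (s - y)^(k+1). *)
Lemma sum_binomial_weight_r (F : comNzRingType) (k : nat) (s : F) :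
  \sum_(i < k.+2) (-1) ^+ i * 'C(k.+1, i)%:R * (i%:R * s ^+ (k.+1 - i))
  = - (k.+1%:R * (s - 1) ^+ k).
Proof.
rewrite big_ord_recl /= mul0r mulr0 add0r exprBn mulr_sumr -sumrN.
apply: eq_bigr => i _; rewrite /bump /= add1n subSS expr1n mulr1 -mulr_natr.
have /(congr1 (fun n => n%:R : F)) := mul_bin_diag k.+1 i.
rewrite /= !natrM => e.
transitivity (- ((-1) ^+ i * s ^+ (k - i) * (i.+1%:R * 'C(k.+1, i.+1)%:R))).
  by rewrite exprS; ring.
by rewrite -e; ring.
Qed.

(** The sum of (x - y)^K over x in the fibre of w and y in the fibre of v, expanded into power sums
    so as to be a polynomial in w (outer variable) and v (inner variable). *)
Definition pair_power (F : fieldType) (g : {poly F}) (K : nat) :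
    {poly {poly F}} :=
  \sum_(i < K.+1) ((-1) ^+ i * 'C(K, i)%:R)%:P%:P *
     ((psum g (K - i))^:P * (psum g i)%:P).

Lemma coef_pair_power (F : fieldType) (g : {poly F}) (K a b : nat) :
  (pair_power g K)`_a`_b =
  \sum_(i < K.+1) (-1) ^+ i * 'C(K, i)%:R *
     ((psum g (K - i))`_a * (psum g i)`_b).
Proof.
rewrite /pair_power !coef_sum; apply: eq_bigr => i _.
by rewrite coefCM coefCM coefMC coef_map /= coefCM.
Qed.

Lemma horner_pair_power (F : closedFieldType) (g : {poly F}) (K : nat)
    (w v : F) :
  g \is monic -> (1 < size g)%N ->
  (pair_power g K).[w%:P].[v] =
  \sum_(x <- roots_of g w) \sum_(y <- roots_of g v) (x - y) ^+ K.
Proof.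
move=> gm g1.
under [RHS]eq_bigr => x _ do under eq_bigr => y _ do rewrite exprBn.
under [RHS]eq_bigr => x _ do rewrite exchange_big /=.
rewrite [RHS]exchange_big /= /pair_power !horner_sum; apply: eq_bigr => i _.
rewrite !hornerM !hornerC horner_map /= !hornerC -!psum_roots_of //.
rewrite big_distrlr mulr_sumr; apply: eq_bigr => x _.
rewrite mulr_sumr; apply: eq_bigr => y _; rewrite -[RHS]mulr_natr /=; ring.
Qed.

(** The quotients of K - i and i by d add up to at most K / d, which is m since r < d. *)
Lemma total_degree_pair_power (F : fieldType) (g : {poly F}) (m r : nat) :
  (r < (size g).-1)%N ->
  total_degree_le m (pair_power g ((size g).-1 * m + r)).
Proof.
set d := (size g).-1 => rd a b ab; have d0 : (0 < d)%N by lia.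
have g1 : (1 < size g)%N by move: d0; rewrite /d; lia.
rewrite coef_pair_power big1 // => i _; have := ltn_ord i.
set K := (d * m + r)%N; rewrite ltnS => iK.
have [ha|ha] := ltnP ((K - i) %/ d) a.
  by rewrite [X in _ * (X * _)]nth_default ?mul0r ?mulr0 // (leq_trans (size_psum _ g1)).
have [hb|hb] := ltnP (i %/ d) b.
  by rewrite [X in _ * (_ * X)]nth_default ?mulr0 // (leq_trans (size_psum _ g1)).
have : (K %/ d = m)%N by rewrite /K mulnC divnMDl // divn_small // addn0.
have : ((K - i) %/ d + i %/ d <= K %/ d)%N; last by lia.
rewrite leq_divRL // mulnDl.
by apply: leq_trans (leq_add (leq_trunc_div _ _) (leq_trunc_div _ _)) _; rewrite subnK.
Qed.

(** Write i = d s + e with e < d. For e > r the product has degree below m, and for 0 < e < r the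
    coefficient vanishes by [coef_psum_subleading]. For e = 0 or e = r exactly one factor carries
    g_(d-r). The conditions d | i and d | K - i are written as sums over d-th roots of unity, so
    that the later sum over i is binomial. *)
Lemma psum_pair_top (F : closedFieldType) (g : {poly F}) (m r i : nat) (t : F) :
  g \is monic -> (0 < r < (size g).-1)%N ->
  (forall l, ((size g).-1 - r < l < (size g).-1)%N -> g`_l = 0) ->
  t != 0 ->
  let d := (size g).-1 in let K := (d * m + r)%N in
  (i <= K)%N ->
  \sum_(a < m.+1) (psum g (K - i))`_a * (psum g i)`_(m - a) * (t ^+ d) ^+ a =
  - g`_(d - r) * \sum_(x <- roots_of 'X^d 1)
     ((t ^- r * x ^+ (d - r)) * ((K - i)%:R * (x * t) ^+ (K - i))
      + i%:R * (x * t) ^+ (K - i)).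
Proof.
move=> gm /andP[r0 rd] g0 tn0 d K iK; have d0 : (0 < d)%N by lia.
have g1 : (1 < size g)%N by move: d0; rewrite /d; lia.
have filter : \sum_(x <- roots_of 'X^d 1)
     ((t ^- r * x ^+ (d - r)) * ((K - i)%:R * (x * t) ^+ (K - i))
      + i%:R * (x * t) ^+ (K - i)) =
   t ^- r * t ^+ (K - i) * (K - i)%:R * (if (d %| i)%N then d%:R else 0)
   + i%:R * t ^+ (K - i) * (if (d %| K - i)%N then d%:R else 0).
  have -> : (if (d %| i)%N then d%:R else 0) =
      \sum_(x <- roots_of 'X^d 1) x ^+ (d - r + (K - i)) :> F.
    rewrite sum_roots_of_Xn // expr1n mulr1.
    rewrite (_ : (d %| d - r + (K - i))%N = (d %| i)%N) //.
    have -> : (d - r + (K - i) = d * m.+1 - i)%N by rewrite mulnS /K; lia.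
    by rewrite dvdn_subr ?dvdn_mulr // mulnS; lia.
  have -> : (if (d %| K - i)%N then d%:R else 0) =
      \sum_(x <- roots_of 'X^d 1) x ^+ (K - i) :> F.
    by rewrite sum_roots_of_Xn // expr1n mulr1.
  rewrite !mulr_sumr -big_split; apply: eq_bigr => x _ /=.
  by rewrite !exprMn exprD; ring.
rewrite filter.
have szle j c : (j %/ d < c)%N -> (psum g j)`_c = 0.
  by move=> jc; rewrite nth_default // (leq_trans (size_psum _ g1)).
have iE := divn_eq i d; have ed := ltn_pmod i d0.
set s := (i %/ d)%N in iE; set e := (i %% d)%N in iE ed.
have dvi : (d %| i)%N = (e == 0)%N by [].
have sm : (s <= m)%N.
  by rewrite -ltnS -(ltn_pmul2l d0) mulnC mulnS; move: iK; rewrite /K; lia.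
have [re|er] := ltnP r e.
  have dvKi : (d %| K - i)%N = false.
    have -> : (K - i = (m - s.+1) * d + (d + r - e))%N.
      have : (s < m)%N.
        by rewrite -(ltn_pmul2l d0) mulnC; move: iK; rewrite /K; lia.
      move=> sm'; rewrite mulnBl mulSn /K mulnC.
      have : (s.+1 * d <= m * d)%N by rewrite leq_mul2r sm' orbT.
      by rewrite mulSn; lia.
    by rewrite /dvdn modnMDl modn_small; lia.
  rewrite dvi dvKi (_ : (e == 0)%N = false); last by lia.
  rewrite !mulr0 addr0 mulr0 big1 // => a _; have am := ltn_ord a.
  have [ha|ha] := ltnP ((K - i) %/ d) a; first by rewrite szle ?mul0r.
  rewrite [X in _ * X * _]szle ?mulr0 ?mul0r // -/s.
  have : ((K - i) %/ d < m - s)%N; last by lia.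
  rewrite ltn_divLR // mulnBl; move: iK; rewrite /K; lia.
have Kie : (K - i = d * (m - s) + (r - e))%N.
  have : (s * d <= m * d)%N by rewrite leq_mul2r sm orbT.
  by rewrite mulnBr /K [(d * s)%N]mulnC [(d * m)%N]mulnC; lia.
have quo : ((K - i) %/ d = m - s)%N.
  by rewrite Kie mulnC divnMDl // divn_small ?addn0 //; lia.
have lt : (m - s < m.+1)%N by lia.
rewrite (bigD1 (Ordinal lt)) //= [X in _ + X]big1 ?addr0 => [|a an]; last first.
  have am := ltn_ord a.
  have {}an : (nat_of_ord a != m - s)%N by move: an; rewrite -val_eqE.
  have [ha|ha] := ltnP ((K - i) %/ d) a; first by rewrite szle ?mul0r.
  by rewrite [X in _ * X * _]szle ?mulr0 ?mul0r // -/s; lia.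
have -> : (m - (m - s) = s)%N by lia.
have iE' : i = (d * s + e)%N by rewrite mulnC.
have dvKi : (d %| K - i)%N = (r - e == 0)%N.
  by rewrite Kie /dvdn mulnC modnMDl modn_small; lia.
rewrite dvi dvKi.
have [e0|e0] := posnP e.
  rewrite e0 subn0 (gtn_eqF r0) mulr0 addr0.
  rewrite e0 addn0 in iE'; rewrite e0 subn0 in Kie.
  rewrite {1}Kie (@coef_psum_subleading _ g r) ?r0 ?leqnn // eqxx -/d -Kie.
  rewrite (congr1 (psum g) iE') coef_psum_mul // -/d.
  have -> : t ^- r * t ^+ (K - i) = (t ^+ d) ^+ (m - s).
    by rewrite Kie exprD exprM; field; rewrite expf_neq0.
  ring.
rewrite mulr0 add0r.
have [re|re] := eqVneq e r; last first.
  rewrite (congr1 (psum g) iE') (@coef_psum_subleading _ g r) ?e0 // (negbTE re) mulr0 mul0r.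
  by rewrite (_ : (r - e == 0)%N = false) ?mulr0 ?mulr0 //; lia.
rewrite re subnn eqxx; rewrite re subnn addn0 in Kie; rewrite re in iE'.
rewrite (congr1 (psum g) iE') (@coef_psum_subleading _ g r) ?r0 ?leqnn // eqxx -/d -iE'.
rewrite (congr1 (psum g) Kie) coef_psum_mul // -/d Kie exprM; ring.
Qed.

(** For each root of unity x the sum over i is a binomial expansion with weights K - i and i, whence
    the factor K. For t near -1 the root x = 1 dominates, with |x t - 1| close to 2 and last factor
    t^(1-r) - 1. *)
Lemma top_form_pair_power (F : closedFieldType) (g : {poly F}) (m r : nat)
    (t : F) :
  g \is monic -> (0 < r < (size g).-1)%N ->
  (forall l, ((size g).-1 - r < l < (size g).-1)%N -> g`_l = 0) ->
  t != 0 ->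
  let d := (size g).-1 in let K := (d * m + r)%N in
  (top_form m (pair_power g K)).[t ^+ d] =
  - g`_(d - r) * K%:R * \sum_(x <- roots_of 'X^d 1)
     (x * t - 1) ^+ K.-1 * (t ^- r * x ^+ (d - r) * (x * t) - 1).
Proof.
move=> gm r0d g0 tn0 d K; rewrite /top_form horner_poly.
under eq_bigr => a _ do rewrite coef_pair_power mulr_suml.
rewrite exchange_big /=.
rewrite (eq_bigr (fun i : 'I_K.+1 => - g`_(d - r) * \sum_(x <- roots_of 'X^d 1)
   ((t ^- r * x ^+ (d - r)) *
     ((-1) ^+ i * 'C(K, i)%:R * ((K - i)%:R * (x * t) ^+ (K - i)))
      + (-1) ^+ i * 'C(K, i)%:R * (i%:R * (x * t) ^+ (K - i))))); last first.
  move=> i _; have iK : (i <= K)%N by rewrite -ltnS ltn_ord.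
  rewrite -(eq_bigr _ (fun a _ => mulrA _ _ _)) /= -mulr_sumr.
  rewrite psum_pair_top // mulrCA; congr (_ * _); rewrite mulr_sumr.
  by apply: eq_bigr => x _; ring.
rewrite -mulr_sumr -mulrA; congr (_ * _); rewrite exchange_big mulr_sumr /=.
apply: eq_bigr => x _; rewrite big_split /= -mulr_sumr.
have KS : K = K.-1.+1 by move: r0d => /andP[r0 _]; rewrite /K; lia.
by rewrite KS sum_binomial_weight_l sum_binomial_weight_r /=; ring.
Qed.

(** * The equality case *)

Lemma cabs_expB1 (R : realType) (s : R[i]) (k : nat) :
  cabs s = 1 -> cabs (s ^+ k - 1) <= k%:R * cabs (s - 1).
Proof.
move=> s1; elim: k => [|k IH]; first by rewrite subrr cabs0 mul0r.
apply: le_trans (@cabs_triangle _ _ s _) _.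
have -> : s ^+ k.+1 - s = s * (s ^+ k - 1) by rewrite exprS; ring.
by rewrite cabsM s1 mul1r -natr1 mulrDl mul1r lerD2r.
Qed.

(* Rational points of the circle: [u = - (1 + i t) / (1 - i t)] is at         *)
(* distance of order [t] from the antipode of [1].                            *)
Lemma near_antipode (R : realType) (t : R) (k : nat) :
  (0 < k)%N -> 0 < t -> 4 * k%:R ^+ 2 * t <= 1 ->
  exists u : R[i], [/\ cabs u = 1, cabs (u + 1) <= 2 * t,
    (1 - t ^+ 2) * 4 <= cabs (u - 1) ^+ 2 & t / 2 <= cabs (u ^+ k - 1)].
Proof.
move=> k0 t0 kt; have k1 : 1 <= k%:R :> R by rewrite ler1n.
have t1 : t <= 1 by nra.
pose p : R[i] := (1 +i* t)%C; pose q : R[i] := (1 +i* (- t))%C.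
pose n : R := Num.sqrt (1 + t ^+ 2).
have cp : cabs p = n by rewrite /cabs /p /n /= expr1n.
have cq : cabs q = n by rewrite /cabs /q /n /= expr1n sqrrN.
have n2 : n ^+ 2 = 1 + t ^+ 2 by rewrite sqr_sqrtr // addr_ge0 ?sqr_ge0.
have n0 : 0 <= n by exact: sqrtr_ge0.
have n1 : 1 <= n by nra.
have nle2 : n <= 2 by nra.
have q0 : q != 0 by rewrite -cabs_gt0 cq; lra.
have pqD : p + q = 2.
  by apply/eqP; rewrite eq_complex /p /q /=; apply/andP; split; apply/eqP; lra.
have pqB : p - q = (2 * t)%:C * 'i.
  apply/eqP; rewrite eq_complex /p /q /=; apply/andP; split; apply/eqP; lra.
have cpqB : cabs (p - q) = 2 * t.
  rewrite /cabs /p /q /= subrr expr0n /= add0r sqrtr_sqr ger0_norm; lra.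
have c2 : cabs (2 : R[i]) = 2 by exact: cabs_nat.
pose s := p / q.
have cs : cabs s = 1 by rewrite cabsM cabsV cp cq divff //; lra.
have sB1 : cabs (s - 1) = 2 * t / n.
  have -> : s - 1 = (p - q) / q by rewrite /s; field.
  by rewrite cabsM cabsV cq cpqB.
have e_le : cabs (s - 1) <= 2 * t by rewrite sB1 ler_pdivrMr; nra.
have e_ge : t <= cabs (s - 1) by rewrite sB1 ler_pdivlMr; nra.
exists (- s); split.
- by rewrite cabsN.
- by rewrite addrC cabsC.
- have -> : - s - 1 = - (p + q) / q by rewrite /s; field.
  rewrite pqD cabsM cabsV cq cabsN c2 expr_div_n n2.
  rewrite ler_pdivlMr; last by nra.
  have := sqr_ge0 (t ^+ 2); nra.
(* For odd k, u^k is close to -1. For even k, u^k - 1 = s^k - 1 is s - 1 times a sum of k terms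
   close to 1. *)
have [ok|ek] := boolP (odd k).
  rewrite exprNn -signr_odd ok expr1 mulN1r.
  have -> : - s ^+ k - 1 = - (2 + (s ^+ k - 1)) by ring.
  rewrite cabsN; have := cabsB_ge 2 (- (s ^+ k - 1)); rewrite opprK cabsN c2.
  have := cabs_expB1 k cs; nra.
rewrite exprNn -signr_odd (negbTE ek) expr0 mul1r.
rewrite subrX1 cabsM.
have -> : \sum_(i < k) s ^+ i = k%:R - \sum_(i < k) (1 - s ^+ i).
  by rewrite sumrB sumr_const card_ord subKr.
have := cabsB_ge k%:R (\sum_(i < k) (1 - s ^+ i)); rewrite cabs_nat.
set S := \sum_(i < k) _; set e := cabs (s - 1) in e_le e_ge *.
have Se : cabs S <= k%:R * (k%:R * e).
  apply: le_trans (cabs_sum _ _ _) _.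
  rewrite mulr_natl -[X in _ *+ X]card_ord -sumr_const; apply: ler_sum => i _.
  rewrite cabsC; apply: le_trans (cabs_expB1 _ cs) _.
  by rewrite ler_wpM2r ?cabs_ge0 // ler_nat ltnW.
set z := cabs (_ - S) => hz.
have z2 : 1 / 2 <= z by nra.
nra.
Qed.

(** By the parallelogram law |x + 1| = 2 on the unit circle only at x = 1, and W is finite. This
    makes the roots of unity other than 1 contribute exponentially less than 2^K. *)
Lemma circle_antipode_gap (R : realType) (W : seq R[i]) :
  (forall x, x \in W -> cabs x = 1) ->
  exists eta : R, [/\ 0 < eta, eta <= 1 &
    forall x, x \in W -> x != 1 -> cabs (x + 1) <= 2 - 2 * eta].
Proof.
elim: W => [|y W IH] cW; first by exists 1.
have [x xW|eta [eta0 eta1 hW]] := IH; first by apply: cW; rewrite inE xW orbT.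
have [->|y1] := eqVneq y 1.
  by exists eta; split=> // x; rewrite inE => /predU1P[->|/hW//]; rewrite eqxx.
have cy : cabs y = 1 by apply: cW; rewrite inE eqxx.
have y2 : cabs (y + 1) < 2.
  have := cabs_parallelogram y 1; rewrite cy cabs1.
  have : 0 < cabs (y - 1) by rewrite cabs_gt0 subr_eq0.
  have := cabs_ge0 (y + 1); nra.
exists (Num.min eta ((2 - cabs (y + 1)) / 2)); split.
- by rewrite lt_min eta0 divr_gt0 // subr_gt0.
- by rewrite ge_min eta1.
set e := Num.min _ _; have e1 : e <= eta by rewrite ge_min lexx.
have e2 : e <= (2 - cabs (y + 1)) / 2 by rewrite ge_min lexx orbT.
move=> x; rewrite inE => /predU1P[->|/hW h /h]; lra.
Qed.

(* With [K = d m + r], the leading form of [pair_power g K] near the antipode *)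
(* is of order [sqrt K * 2 ^ K] times the coefficient, while it is bounded by *)
(* a constant times [2 ^ K].                                                  *)
Lemma rigidity_subleading (R : realType) (E : R[i] -> Prop) (B : R)
    (g : {poly R[i]}) (r : nat) :
  infinite_pred E -> (forall z, E z -> cabs z <= B) ->
  g \is monic -> (1 < r < (size g).-1)%N -> (forall z, E g.[z] -> E z) ->
  (forall x y, E x -> E y -> cabs (x - y) <= 2) ->
  (forall l, ((size g).-1 - r < l < (size g).-1)%N -> g`_l = 0) ->
  g`_((size g).-1 - r) = 0.
Proof.
move=> hE bE gm; set d := (size g).-1 => /andP[r1 rd] invg diamE g0.
have g2 : (2 < size g)%N by move: rd; rewrite /d; lia.
have d0 : (0 < d)%N by lia.
have r0d : (0 < r < d)%N by lia.
have r0 : (0 < r)%N by lia.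
have k0 : (0 < r.-1)%N by lia.
have g1 : (1 < size g)%N by exact: ltnW.
apply/eqP; rewrite -cabs_eq0; apply/negPn/negP => gam_neq0.
set gam := g`_(d - r) in gam_neq0.
have gam0 : 0 < cabs gam by rewrite lt0r gam_neq0 cabs_ge0.
pose W := roots_of ('X^d : {poly R[i]}) 1.
have sXd : (1 < size ('X^d : {poly R[i]}))%N by rewrite size_polyXn; lia.
have memW x : (x \in W) = (x ^+ d == 1).
  by rewrite mem_roots_of // hornerXn.
have cW x : x \in W -> cabs x = 1.
  rewrite memW => /eqP/(congr1 (@cabs R)); rewrite cabsX cabs1 => /eqP.
  by rewrite pexpr_eq1 ?cabs_ge0 // => /eqP.
have sW : size W = d by rewrite size_roots_of // size_polyXn.
have [eta [eta0 eta1 hW]] := circle_antipode_gap cW.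
pose C := 2 * d%:R / eta.
have C0 : 0 <= C by rewrite divr_ge0 ?mulr_ge0 // ltW.
(* The relation 2 K t^2 = 1 is the balance: (1 - t^2)^(K-1) stays above 1/2, while K t is of order 1
   / t and unbounded as t tends to 0. *)
have key m t : 0 < t -> 4 * (r.-1)%:R ^+ 2 * t <= 1 -> 2 * t <= eta ->
    2 * (d * m + r)%:R * t ^+ 2 = 1 ->
    cabs gam * (1 / (16 * t) - C) <= d%:R ^+ 2.
  move=> t0 t1 t2; set K := (d * m + r)%N => Kt.
  have KS : K = K.-1.+1 by rewrite prednK // addn_gt0 r0 orbT.
  have [u [cu u1 uB uk]] := near_antipode k0 t0 t1.
  have u0 : u != 0 by rewrite -cabs_gt0 cu.
  (* The two fibres give d^2 pairs of points of E, each at distance at most 2. *)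
  have : cabs (top_form m (pair_power g K)).[u ^+ d] <= d%:R ^+ 2 * 2 ^+ K.
    apply: (torus_bound hE bE gm g2 invg) => [||x y Ex Ey].
    - exact: total_degree_pair_power.
    - by rewrite cabsX cu expr1n.
    rewrite horner_pair_power //.
    apply: le_trans (cabs_sum _ _ _) _.
    apply: (@le_trans _ _ (\sum_(x0 <- roots_of g x) d%:R * 2 ^+ K)).
      rewrite big_seq [leRHS]big_seq; apply: ler_sum => x0 x0r.
      apply: le_trans (cabs_sum _ _ _) _.
      apply: (@le_trans _ _ (\sum_(y0 <- roots_of g y) 2 ^+ K)).
        rewrite big_seq [leRHS]big_seq; apply: ler_sum => y0 y0r.
        move: x0r y0r; rewrite !mem_roots_of // => /eqP gx0 /eqP gy0.
        rewrite cabsX lerXn2r ?nnegrE ?cabs_ge0 // diamE //.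
          by apply: invg; rewrite gx0.
        by apply: invg; rewrite gy0.
      rewrite big_const_seq iter_addr_0 count_predT size_roots_of //.
      by rewrite mulr_natl.
    rewrite big_const_seq iter_addr_0 count_predT size_roots_of //.
    by rewrite expr2 -mulrA [X in _ <= X]mulr_natl.
  rewrite (top_form_pair_power _ gm r0d g0 u0).
  rewrite -/d -/gam -/K !cabsM cabsN cabs_nat -/W.
  set T := \sum_(x <- W) _ => HT.
  (* The root x = 1 gives the main term; for the others |x u - 1| <= |u + 1| + |x + 1| <= 2 -
     eta. *)
  have Tlow : 2 ^+ K.-1 / 2 * (t / 2) - d%:R * (2 * (2 - eta) ^+ K.-1) <= cabs T.
    rewrite /T (bigID (fun x => x == 1)) /=; set T1 := \sum_(x <- W | x == 1) _.
    set T2 := \sum_(x <- W | x != 1) _.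
    have hT2 : cabs T2 <= d%:R * (2 * (2 - eta) ^+ K.-1).
      apply: le_trans (cabs_sum _ _ _) _.
      have -> : d%:R * (2 * (2 - eta) ^+ K.-1) =
          \sum_(x <- W) 2 * (2 - eta) ^+ K.-1.
        by rewrite big_const_seq iter_addr_0 count_predT sW mulr_natl.
      rewrite [leLHS]big_mkcond /= big_seq [leRHS]big_seq; apply: ler_sum => x xW.
      have e20 : 0 <= 2 - eta by lra.
      case: ifP => [xn1|_]; last by rewrite mulr_ge0 ?exprn_ge0.
      rewrite cabsM cabsX mulrC; apply: ler_pM; rewrite ?cabs_ge0 ?exprn_ge0 ?cabs_ge0 //.
        apply: le_trans (cabsD _ _) _.
        by rewrite cabsN cabs1 !cabsM cabsV !cabsX cu cW // !expr1n invr1 !mulr1.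
      rewrite lerXn2r ?nnegrE ?cabs_ge0 //.
      have -> : x * u - 1 = x * (u + 1) - (x + 1) by ring.
      apply: le_trans (cabsD _ _) _; rewrite cabsN cabsM cW // mul1r.
      have := hW _ xW xn1; lra.
    have hT1 : 2 ^+ K.-1 / 2 * (t / 2) <= cabs T1.
      rewrite /T1 (eq_bigr (fun=> (u - 1) ^+ K.-1 * (u ^- r * u - 1))); last first.
        by move=> x /eqP->; rewrite expr1n !mul1r mulr1.
      rewrite big_const_seq iter_addr_0 -[X in cabs X]mulr_natr cabsM cabs_nat.
      have c1 : leq 1 (count (fun x : R[i] => x == 1) W).
        by rewrite -has_count has_pred1 memW expr1n.
      rewrite -[leLHS]mulr1 ler_pM ?ler1n ?mulr_ge0 ?exprn_ge0 ?invr_ge0 ?(ltW t0) //.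
      have ur : u ^- r * u = (u ^+ r.-1)^-1.
        have -> : r = r.-1.+1 by rewrite prednK.
        by rewrite exprSr /=; field; rewrite u0 expf_neq0.
      have -> : u ^- r * u - 1 = - (u ^- r.-1) * (u ^+ r.-1 - 1).
        by rewrite ur; field; rewrite expf_neq0.
      rewrite cabsM cabsX [cabs (_ * (_ - 1))]cabsM cabsN cabsV cabsX cu expr1n.
      rewrite invr1 mul1r ler_pM ?mulr_ge0 ?exprn_ge0 ?invr_ge0 ?(ltW t0) //.
      rewrite -ler_sqr ?nnegrE ?mulr_ge0 ?exprn_ge0 ?invr_ge0 ?cabs_ge0 //.
      rewrite -exprM mulnC exprM.
      have h1 : ((1 - t ^+ 2) * 4) ^+ K.-1 <= (cabs (u - 1) ^+ 2) ^+ K.-1.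
        rewrite lerXn2r ?nnegrE ?sqr_ge0 //; nra.
      apply: le_trans h1; rewrite [leRHS]exprMn.
      have h2 : 1 + K.-1%:R * (- t ^+ 2) <= (1 + - t ^+ 2) ^+ K.-1.
        by apply: bernoulli; nra.
      have Kr : K%:R = K.-1%:R + 1 :> R by rewrite {1}KS -natr1.
      rewrite Kr in Kt; have h3 : 1 / 2 <= (1 - t ^+ 2) ^+ K.-1.
        by apply: le_trans h2; have := sqr_ge0 t; nra.
      have e4 : (4 : R) ^+ K.-1 = (2 ^+ K.-1) ^+ 2.
        by rewrite -exprM mulnC exprM; congr (_ ^+ _); ring.
      rewrite e4 expr_div_n; have := sqr_ge0 ((2 : R) ^+ K.-1).
      set z := (_ ^+ 2 : R); set y := (1 - _) ^+ _ in h3 *; nra.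
    have := cabsB_ge T1 (- T2); rewrite opprK cabsN; lra.
  pose x := eta / 2; have x0 : 0 < x by rewrite divr_gt0.
  have x1 : x <= 1 by rewrite /x; lra.
  (* This bounds K (1 - x)^(K-1) independently of K: Bernoulli gives (1 + x)^(K-1) >= K x, and (1 -
     x)(1 + x) <= 1. *)
  have rho : K%:R * x * (1 - x) ^+ K.-1 <= 1.
    have h1 : 1 + K.-1%:R * x <= (1 + x) ^+ K.-1 by apply: bernoulli; lra.
    have h2 : ((1 - x) * (1 + x)) ^+ K.-1 <= 1.
      by apply: exprn_ile1; nra.
    apply: le_trans h2; rewrite exprMn mulrC ler_wpM2l ?exprn_ge0 //; first by lra.
    apply: le_trans h1; rewrite {1}KS -natr1; nra.
  have p2 : 0 < (2 : R) ^+ K.-1 by rewrite exprn_gt0.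
  have e2 : (2 - eta) ^+ K.-1 = 2 ^+ K.-1 * (1 - x) ^+ K.-1.
    by rewrite -exprMn; congr (_ ^+ _); rewrite /x; field.
  rewrite e2 in Tlow; have e3 : (2 : R) ^+ K = 2 * 2 ^+ K.-1 by rewrite -exprS -KS.
  rewrite e3 in HT.
  have K0 : 0 <= K%:R :> R by [].
  have HT2 : cabs gam * K%:R * (2 ^+ K.-1 / 2 * (t / 2) -
      d%:R * (2 * (2 ^+ K.-1 * (1 - x) ^+ K.-1))) <= d%:R ^+ 2 * (2 * 2 ^+ K.-1).
    by apply: le_trans HT; rewrite ler_wpM2l // mulr_ge0 ?cabs_ge0.
  have p4 : 0 < 2 * (2 : R) ^+ K.-1 by rewrite mulr_gt0.
  rewrite -(ler_pM2r p4).
  apply: le_trans HT2.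
  have -> : cabs gam * K%:R * (2 ^+ K.-1 / 2 * (t / 2) -
      d%:R * (2 * (2 ^+ K.-1 * (1 - x) ^+ K.-1))) =
    cabs gam * (K%:R * t / 8 - d%:R * (K%:R * (1 - x) ^+ K.-1)) * (2 * 2 ^+ K.-1).
    by field.
  rewrite ler_pM2r; last by rewrite mulr_gt0.
  rewrite ler_wpM2l ?cabs_ge0 // lerB //.
    rewrite ler_pdivrMr ?mulr_gt0 //.
    have -> : K%:R * t / 8 * (16 * t) = 2 * K%:R * t ^+ 2 by field.
    by rewrite Kt.
  rewrite /C [2 * _]mulrC -mulrA ler_wpM2l //.
  rewrite (_ : 2 / eta = x^-1); last by rewrite /x; field; lra.
  by rewrite -[leRHS]mul1r ler_pdivlMr // mulrAC.
pose A := C + d%:R ^+ 2 / cabs gam + 1.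
have A0 : 0 < A by rewrite ltr_wpDl // addr_ge0 // divr_ge0 ?sqr_ge0 ?cabs_ge0.
pose k : R := (r.-1)%:R; have kp : 0 < k by rewrite ltr0n.
(* The first two bounds are the conditions of [key] on t; the third makes 1 / (16 t) exceed A, which
   contradicts [key]. *)
pose del := Num.min (1 / (4 * k ^+ 2)) (Num.min (eta / 2) (1 / (16 * A))).
have del0 : 0 < del.
  by rewrite !lt_min !divr_gt0 ?mulr_gt0 // exprn_gt0.
pose m := Num.bound (1 / (2 * del ^+ 2)); pose K := (d * m + r)%N.
have Kdel : 1 / (2 * del ^+ 2) < K%:R.
  apply: (@lt_le_trans _ _ m%:R).
    by apply: archi_boundP; rewrite ltW // divr_gt0 ?mulr_gt0 ?exprn_gt0 //.
  rewrite ler_nat /K; apply: leq_trans (leq_addr _ _); exact: leq_pmull.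
have Kp : 0 < K%:R :> R by rewrite ltr0n addn_gt0 r0 orbT.
pose t : R := Num.sqrt (1 / (2 * K%:R)).
have t0 : 0 < t by rewrite sqrtr_gt0 divr_gt0 ?mulr_gt0.
have t2 : t ^+ 2 = 1 / (2 * K%:R) by rewrite sqr_sqrtr ?divr_ge0 ?mulr_ge0.
have td : t < del.
  rewrite -ltr_sqr ?nnegrE ?ltW // t2 ltr_pdivrMr ?mulr_gt0 //.
  by move: Kdel; rewrite ltr_pdivrMr ?mulr_gt0 ?exprn_gt0 //; lra.
move: td; rewrite !lt_min => /and3P[td1 td2 td3].
have h1 : 4 * k ^+ 2 * t <= 1.
  by move: td1; rewrite ltr_pdivlMr ?mulr_gt0 ?exprn_gt0 //; lra.
have h2 : 2 * t <= eta by move: td2; rewrite ltr_pdivlMr //; lra.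
have h3 : 2 * K%:R * t ^+ 2 = 1 by rewrite t2; field; rewrite gt_eqF.
move: (key m t t0 h1 h2 h3); rewrite mulrC -ler_pdivlMr // leNgt => /negP; apply.
move: td3; rewrite ltr_pdivlMr ?mulr_gt0 // => tA.
have : A < 1 / (16 * t) by rewrite ltr_pdivlMr ?mulr_gt0 //; lra.
by rewrite /A; lra.
Qed.

(** Induction on the distance r from the leading coefficient. The case r = 1, where u^(r-1) - 1 is
    zero and the antipodal argument gives nothing, is the centring hypothesis. *)
Lemma rigidity_middle (R : realType) (E : R[i] -> Prop) (B : R)
    (g : {poly R[i]}) :
  infinite_pred E -> (forall z, E z -> cabs z <= B) ->
  g \is monic -> (forall z, E g.[z] -> E z) ->
  (forall x y, E x -> E y -> cabs (x - y) <= 2) ->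
  g`_((size g).-2) = 0 ->
  forall l, (0 < l < (size g).-1)%N -> g`_l = 0.
Proof.
move=> hE bE gm invg diamE gc.
suff H r : (0 < r < (size g).-1)%N -> g`_((size g).-1 - r) = 0.
  by move=> l ld; have := H ((size g).-1 - l)%N; rewrite subKn; [apply; lia|lia].
elim/ltn_ind: r => r IH rd; have [->|/eqP r1] := eqVneq r 1%N; first by rewrite subn1.
apply: (rigidity_subleading hE bE gm) => //; first by case/andP: rd => r0 ->; rewrite andbT; lia.
by move=> l ld0; have ld : ((size g).-1 - r < l < (size g).-1)%N := ld0; have := IH ((size g).-1 - l)%N; rewrite subKn; [apply; lia|lia].
Qed.

(** After [rigidity_middle] only the constant term c is left. E is also backward invariant under the
    second iterate (X^d + c)^d + c, whose middle coefficient at X^(d(d-1)) is d c, so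
    [rigidity_middle] again gives c = 0. *)
Lemma rigidity_monic (R : realType) (E : R[i] -> Prop) (B : R)
    (g : {poly R[i]}) :
  infinite_pred E -> (forall z, E z -> cabs z <= B) ->
  g \is monic -> (2 < size g)%N -> (forall z, E g.[z] -> E z) ->
  (forall x y, E x -> E y -> cabs (x - y) <= 2) ->
  g`_((size g).-2) = 0 ->
  g = 'X^((size g).-1).
Proof.
move=> hE bE gm g2 invg diamE gc; set d := (size g).-1.
have mid := rigidity_middle hE bE gm invg diamE gc; rewrite -/d in mid.
have d2 : (1 < d)%N by rewrite /d; lia.
have sg : size g = d.+1 by rewrite /d; lia.
pose c := g`_0; have gE : g = 'X^d + c%:P.
  apply/polyP => l; rewrite coefD coefXn coefC.
  have [->|l0] := posnP l; first by rewrite ltn_eqF ?add0r // ltnW.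
  rewrite addr0; have [ld|ld|->] := ltngtP l d.
  - by rewrite mid // l0 ld.
  - by rewrite nth_default // sg.
  - by move/monicP: gm.
suff c0 : c = 0 by rewrite gE c0 addr0.
pose h := g \Po g.
have hm : h \is monic by apply: comp_monic => //; exact: ltnW.
have hs : size h = (d * d).+1.
  have : (size h).-1 = (d * d)%N by rewrite size_comp_poly.
  have : (0 < d * d)%N by rewrite muln_gt0; lia.
  by case: (size h) => [|n] /=; lia.
have hinv z : E h.[z] -> E z by rewrite horner_comp => /invg /invg.
have hcoef j : (0 < j)%N -> h`_j =
    \sum_(i < d.+1) (j == d * (d - i))%N%:R * (c ^+ i *+ 'C(d, i)).
  move=> j0; rewrite /h [X in X \Po _]gE comp_polyD comp_polyC comp_Xn_poly coefD coefC.
  rewrite (gtn_eqF j0) addr0 gE exprDn coef_sum; apply: eq_bigr => i _.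
  by rewrite coefMn -exprM -rmorphXn coefMC coefXn -mulrnAr.
have d0 : (0 < d)%N by exact: ltnW.
have dd : (d < d * d)%N by rewrite ltn_Pmull.
have hc : h`_((size h).-2) = 0.
  rewrite hs /= hcoef; last by rewrite -subn1 subn_gt0 (ltn_trans d2 dd).
  rewrite big1 // => i _; rewrite (_ : (_ == _)%N = false) ?mul0r //.
  apply/negP => /eqP e; have /(congr1 (modn^~ d)) := e; rewrite modnMr.
  have -> : ((d * d).-1 = d.-1 * d + d.-1)%N.
    by rewrite -{1}(prednK d0) mulSn addnC -subn1 -addnBA // subn1.
  by rewrite modnMDl modn_small ?prednK // -subn1 => /eqP; rewrite subn_eq0 leqNgt d2.
have := rigidity_middle hE bE hm hinv diamE hc; rewrite hs /=.
move=> /(_ (d * (d - 1))%N); rewrite hcoef; last by rewrite muln_gt0 d0 subn_gt0.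
have l1 : (1 < d.+1)%N by exact: ltnW.
rewrite (bigD1 (Ordinal l1)) //= eqxx mul1r expr1 bin1 big1 ?addr0 => [|i i1].
  move=> H; apply/eqP; move: H; rewrite -mulr_natr => H.
  have /eqP : c * d%:R = 0 by apply: H; rewrite muln_gt0 d0 subn_gt0 d2 ltn_pmul2l // ltn_subrL d0.
  by rewrite mulf_eq0 pnatr_eq0 => /orP[//|]; rewrite gtn_eqF.
rewrite (_ : (_ == _)%N = false) ?mul0r // eqn_pmul2l //.
have {}i1 : (nat_of_ord i != 1)%N by move: i1; rewrite -val_eqE.
rewrite eqn_sub2lE //; last by rewrite -ltnS ltn_ord.
by rewrite eq_sym (negbTE i1).
Qed.

(* Summing [(z0 - x)^D x^(D - h)] over the roots of [x^D = w] isolates the     *)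
(* binomial term of index [h]; all of them together give                      *)
(* [(1 + |z0|)^D = O(D 2^D)].                                                 *)
Lemma pure_power_bound (R : realType) (E : R[i] -> Prop) (d : nat) (z0 : R[i]) :
  infinite_pred E -> (1 < d)%N -> (forall z, E (z ^+ d) -> E z) ->
  (forall x y, E x -> E y -> cabs (x - y) <= 2) ->
  E z0 -> cabs z0 <= 1.
Proof.
move=> hE d1 invE diamE Ez0.
have [w [Ew w0]] : exists w, E w /\ w != 0.
  have [s [us ss sE]] := infinite_pred_uniq 2 hE.
  case: s us ss sE => [|x [|y []]] //=; rewrite inE andbT => xy _ sE.
  have [x0|x0] := eqVneq x 0; last by exists x; split=> //; apply: sE; rewrite inE eqxx.
  by exists y; split; [apply: sE; rewrite !inE eqxx orbT|rewrite -x0 eq_sym].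
have cw : 0 < cabs w by rewrite cabs_gt0.
pose rho := cabs z0; pose rho' := Num.max 1 rho.
have rho0 : 0 <= rho by exact: cabs_ge0.
have rho'1 : 1 <= rho' by rewrite le_max lexx.
have rho_le : rho <= rho' by rewrite le_max lexx orbT.
pose V := Num.max 1 (cabs w).
have V1 : 1 <= V by rewrite le_max lexx.
have wV : cabs w <= V by rewrite le_max lexx orbT.
suff : rho + 1 <= 2 by rewrite -/rho; lra.
apply: (@le_of_expr_growth R _ _ (rho' * V / cabs w) (rho' * V / cabs w)
  (fun n => d ^ n.+1)%N) => [|//|n|n]; first by rewrite addr_ge0.
  by apply: ltn_trans (ltnSn n) _; exact: ltn_expl.
set D := (d ^ n.+1)%N; have D2 : (1 < D)%N by rewrite /D -(exp1n n.+1) ltn_exp2r.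
have invD x : E (x ^+ D) -> E x.
  rewrite /D; elim: n.+1 => [|k IH]; first by rewrite expr1.
  by rewrite expnSr exprM => /invE.
have mid h : (0 < h < D)%N -> rho ^+ (D - h) * 'C(D, h)%:R * cabs w <= 2 ^+ D * V.
  move=> hD; pose W := roots_of ('X^D : {poly R[i]}) w.
  have D0 : (0 < D)%N by lia.
  have sXD : (1 < size ('X^D : {poly R[i]}))%N by rewrite size_polyXn; lia.
  have sW : size W = D by rewrite size_roots_of // size_polyXn.
  have WD x : x \in W -> x ^+ D = w by rewrite mem_roots_of // hornerXn => /eqP.
  (* As 0 < h < D and 0 <= i <= D, the exponent i + D - h is a multiple of D only for i = h. *)
  have low : \sum_(x <- W) (z0 - x) ^+ D * x ^+ (D - h) =
      D%:R * ((-1) ^+ h * z0 ^+ (D - h) * w * 'C(D, h)%:R).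
    under eq_bigr => x _ do rewrite exprBn mulr_suml.
    rewrite exchange_big /=.
    have lt : (h < D.+1)%N by lia.
    rewrite (bigD1 (Ordinal lt)) //= [X in _ + X]big1 ?addr0 => [|i ih].
      rewrite (eq_bigr (fun x => ((-1) ^+ h * z0 ^+ (D - h) *+ 'C(D, h)) * x ^+ D)).
        rewrite -mulr_sumr sum_roots_of_Xn // dvdnn divnn D0 expr1.
        by ring.
      move=> x _; have -> : x ^+ D = x ^+ h * x ^+ (D - h) by rewrite -exprD; congr (_ ^+ _); lia.
      by ring.
    have il := ltn_ord i; have {}ih : (nat_of_ord i != h)%N by move: ih; rewrite -val_eqE.
    rewrite (eq_bigr (fun x => ((-1) ^+ i * z0 ^+ (D - i) *+ 'C(D, i)) * x ^+ (i + (D - h)))).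
      rewrite -mulr_sumr sum_roots_of_Xn //.
      rewrite (_ : (D %| i + (D - h))%N = false) ?mulr0 //.
      apply/negP => /dvdnP[q]; case: q => [|[|q]]; rewrite ?mulSn; lia.
    by move=> x _; rewrite exprD; ring.
  have Dp : 0 < D%:R :> R by rewrite ltr0n.
  rewrite -(ler_pM2l Dp).
  have <- : cabs (\sum_(x <- W) (z0 - x) ^+ D * x ^+ (D - h)) =
      D%:R * (rho ^+ (D - h) * 'C(D, h)%:R * cabs w).
    rewrite low !cabsM !cabs_nat !cabsX cabsN cabs1 expr1n mul1r -/rho.
    by ring.
  apply: le_trans (cabs_sum _ _ _) _.
  have -> : D%:R * (2 ^+ D * V) = \sum_(x <- W) 2 ^+ D * V.
    by rewrite big_const_seq iter_addr_0 count_predT sW mulr_natl.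
  rewrite big_seq [leRHS]big_seq; apply: ler_sum => x xW.
  have Ex : E x by apply: invD; rewrite WD.
  rewrite cabsM !cabsX ler_pM ?exprn_ge0 ?cabs_ge0 //.
    by rewrite lerXn2r ?nnegrE ?cabs_ge0 // diamE.
  have [x1|x1] := leP (cabs x) 1.
    by apply: le_trans V1; rewrite exprn_ile1 ?cabs_ge0.
  apply: le_trans wV; rewrite -(WD _ xW) cabsX ler_weXn2l ?leq_subr //.
  exact: ltW.
have p2 : 1 <= (2 : R) ^+ D by rewrite exprn_ege1 // ler1n.
(* The extreme indices escape the filter: h = 0 follows from h = 1 at the cost of a factor [rho'],
   and h = D is immediate. *)
have all h : (h <= D)%N ->
    rho ^+ (D - h) * 'C(D, h)%:R * cabs w <= rho' * V * 2 ^+ D.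
  move=> hD; have [h0|h0] := posnP h.
    have := mid 1%N; rewrite D2 bin1 h0 subn0 bin0 mulr1 => /(_ isT) H1.
    have -> : rho ^+ D = rho * rho ^+ (D - 1) by rewrite -exprS; congr (_ ^+ _); lia.
    have D1 : 1 <= D%:R :> R by rewrite ler1n; lia.
    have r0 : 0 <= rho ^+ (D - 1) by exact: exprn_ge0.
    have H2 : rho ^+ (D - 1) * cabs w <= 2 ^+ D * V.
      apply: le_trans H1; rewrite mulrAC ler_peMr // mulr_ge0 // ltW //.
    rewrite -mulrA -[rho' * V * _]mulrA [V * _]mulrC; apply: ler_pM => //.
    by rewrite mulr_ge0 // ltW.
  have [hDD|hDD] := eqVneq h D.
    rewrite hDD subnn binn expr0 !mul1r.
    apply: (le_trans wV); rewrite -mulrA -[leLHS]mul1r ler_pM ?ler01 //; first by lra.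
    by rewrite -[leLHS]mulr1 ler_pM //; lra.
  apply: le_trans (mid h _) _; first by lia.
  by rewrite [_ * V]mulrC -[leLHS]mul1r -[leRHS]mulrA ler_wpM2r // mulr_ge0 //; lra.
rewrite -(ler_pM2r cw) exprDn mulr_suml.
have -> : (rho' * V / cabs w * D%:R + rho' * V / cabs w) * 2 ^+ D * cabs w =
    \sum_(h < D.+1) rho' * V * 2 ^+ D.
  by rewrite sumr_const card_ord -[RHS]mulr_natl -natr1; field; rewrite gt_eqF.
apply: ler_sum => h _; rewrite expr1n mulr1 -[_ *+ _]mulr_natr; apply: all.
by rewrite -ltnS ltn_ord.
Qed.

(** The leading form of x - y is t - 1, of modulus 2 at t = -1. *)
Lemma diam_ge2_of_monic (R : realType) (E : R[i] -> Prop) (B del : R)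
    (g : {poly R[i]}) :
  infinite_pred E -> (forall z, E z -> cabs z <= B) ->
  g \is monic -> (2 < size g)%N -> (forall z, E g.[z] -> E z) ->
  (forall x y, E x -> E y -> cabs (x - y) <= del) -> 2 <= del.
Proof.
move=> hE bE gm g2 invg hdel.
have deg1 : total_degree_le 1 ('X - 'X%:P : {poly {poly R[i]}}).
  move=> [|[|a]] [|[|b]] //= _; rewrite coefB coefX coefC /=.
  - by rewrite sub0r coefN coefX oppr0.
  - by rewrite subr0 coef1.
  - by rewrite subr0 coef1.
  - by rewrite subrr coef0.
  - by rewrite subrr coef0.
  by rewrite subrr coef0.
have := torus_bound (t := -1) hE bE gm g2 invg deg1.
rewrite cabsN cabs1 => /(_ del erefl).
rewrite /top_form horner_poly !big_ord_recr big_ord0 /= add0r.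
rewrite !coefB !coefX !coefC /= coefX eqxx expr0 expr1.
have -> : (0 - true%:R) * 1 + (1 - 0) * -1 = - 2 :> R[i] by rewrite (_ : true%:R = 1 :> R[i]) //; ring.
rewrite cabsN cabs_nat; apply => x y Ex Ey.
by rewrite hornerD hornerX hornerN hornerC hornerD hornerC hornerN hornerX hdel.
Qed.

(** * Affine normalisation *)

Lemma coef_linear_exp (F : comNzRingType) (l b : F) (n : nat) :
  ((l *: 'X + b%:P) ^+ n)`_n = l ^+ n /\
  ((l *: 'X + b%:P) ^+ n.+1)`_n = n.+1%:R * l ^+ n * b.
Proof.
have step m k : ((l *: 'X + b%:P) ^+ m.+1)`_k.+1 =
    l * ((l *: 'X + b%:P) ^+ m)`_k + b * ((l *: 'X + b%:P) ^+ m)`_k.+1.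
  by rewrite exprS mulrDl coefD -scalerAl coefZ coefXM coefCM.
have szl m : (size ((l *: 'X + b%:P) ^+ m) <= m.+1)%N.
  apply: leq_trans (size_poly_exp_leq _ _) _; rewrite ltnS.
  have sl : (size (l *: 'X + b%:P)%R <= 2)%N.
    apply: leq_trans (size_polyD _ _) _; rewrite geq_max.
    rewrite (leq_trans (size_scale_leq _ _)) ?size_polyX //=.
    exact: leq_trans (size_polyC_leq1 _) _.
  by rewrite -[leqRHS]mul1n leq_mul2r; apply/orP; right; case: (size _) sl => [|[|[]]].
elim: n => [|n [IH1 IH2]].
  by rewrite expr0 coef1 expr0 expr1 coefD coefZ coefX coefC /= mulr0 add0r !mul1r.
have H : ((l *: 'X + b%:P) ^+ n.+1)`_n.+1 = l ^+ n.+1.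
  by rewrite step IH1 [X in b * X]nth_default ?mulr0 ?addr0 ?exprS.
by split=> //; rewrite step IH2 H -[n.+2%:R]natr1 exprS; ring.
Qed.

(** Conjugation by z -> l z + b multiplies the leading coefficient by l^(d-1), and b is the common
    barycentre of the fibres of g, which centres the conjugate. *)
Lemma affine_normal_form (R : realType) (g : {poly R[i]}) :
  (2 < size g)%N ->
  exists l b (h : {poly R[i]}),
    [/\ l != 0, l ^+ (size g).-2 * lead_coef g = 1,
        h \is monic /\ size h = size g, h`_((size h).-2) = 0
      & forall z, l * h.[z] + b = g.[l * z + b]].
Proof.
move=> g2; have [d sg] : exists d, size g = d.+3.
  by case: (size g) g2 => [|[|[|d]]] // _; exists d.
pose a := lead_coef g; have ga : g`_d.+2 = a by rewrite /a /lead_coef sg.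
have a0 : a != 0 by rewrite lead_coef_eq0 -size_poly_eq0 sg.
have [l ld] : exists l, l ^+ d.+1 = a^-1.
  have : exists l, l \in roots_of ('X^(d.+1) : {poly R[i]}) a^-1.
    have := @size_roots_of _ ('X^(d.+1) : {poly R[i]}) a^-1.
    rewrite size_polyXn => /(_ isT); case: roots_of => [|l s] //= _.
    by exists l; rewrite inE eqxx.
  by case=> l; rewrite mem_roots_of ?size_polyXn // hornerXn => /eqP; exists l.
have l0 : l != 0.
  by apply: contra_neq (invr_neq0 a0) => l0; rewrite -ld l0 expr0n.
pose b := - g`_d.+1 / (d.+2%:R * a).
pose psi := l *: 'X + b%:P.
have spsi : size psi = 2%N.
  rewrite /psi size_polyDl size_scale ?size_polyX //.
  exact: leq_ltn_trans (size_polyC_leq1 _) _.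
pose q := g \Po psi - b%:P.
have qcoef k : (0 < k)%N -> q`_k = \sum_(i < d.+3) g`_i * (psi ^+ i)`_k.
  move=> k0; rewrite coefB coefC gtn_eqF // subr0 comp_polyE coef_sum sg.
  by apply: eq_bigr => i _; rewrite coefZ.
have small i k : (i < k)%N -> (psi ^+ i)`_k = 0.
  move=> ik; rewrite nth_default //; apply: leq_trans (size_poly_exp_leq _ _) _.
  by rewrite spsi mul1n.
have sq : (size q <= d.+3)%N.
  apply: leq_trans (size_polyD _ _) _; rewrite geq_max size_polyN.
  rewrite (leq_trans (size_polyC_leq1 _)) // andbT.
  by apply: leq_trans (size_comp_poly_leq _ _) _; rewrite sg spsi muln1.
have q2 : q`_d.+2 = l.
  rewrite qcoef // big_ord_recr big1 /= ?add0r => [|i _].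
    rewrite ga (coef_linear_exp l b d.+2).1 exprS ld; field; exact: a0.
  by rewrite small ?mulr0 ?ltn_ord.
have q1 : q`_d.+1 = 0.
  rewrite qcoef // 2!big_ord_recr big1 /= ?add0r => [|i _].
    rewrite ga (coef_linear_exp l b d.+1).1 (coef_linear_exp l b d.+1).2 /b.
    by field; rewrite a0 /= -natrD pnatr_eq0.
  by rewrite small ?mulr0 ?ltn_ord.
have szq : size q = d.+3.
  apply/eqP; rewrite eqn_leq sq /= ltnNge; apply/negP => /leq_sizeP/(_ d.+2).
  by rewrite leqnn q2 => /(_ isT)/eqP; rewrite (negbTE l0).
exists l, b, (l^-1 *: q); rewrite sg /=; split=> //.
- by rewrite ld mulVf.
- rewrite size_scale ?invr_neq0 //; split=> //.
  by rewrite monicE lead_coefZ lead_coefE szq /= q2 mulVf.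
- by rewrite size_scale ?invr_neq0 // szq /= coefZ q1 mulr0.
move=> z; rewrite hornerZ mulrA mulfV // mul1r /q hornerD hornerN hornerC subrK.
by rewrite horner_comp /psi hornerD hornerZ hornerX hornerC.
Qed.

(* Conjugating by [z -> l z + b] reduces both statements to monic maps with    *)
(* vanishing subleading coefficient, for which [E] has diameter at most 2 in  *)
(* the equality case.                                                          *)
Lemma backward_invariant_diam (R : realType) (E : R[i] -> Prop) (B rho : R)
    (g : {poly R[i]}) :
  infinite_pred E -> (forall z, E z -> cabs z <= B) ->
  (2 < size g)%N -> (forall z, E g.[z] -> E z) -> 0 < rho ->
  (forall x y, E x -> E y -> cabs (x - y) <= 2 * rho) ->
  1 <= cabs (lead_coef g) * rho ^+ (size g).-2 /\
  (cabs (lead_coef g) * rho ^+ (size g).-2 = 1 ->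
   forall z, E z -> cabs (g.[z] - z) <= 2 * rho).
Proof.
move=> hE bE g2 invg rho0 hdiam.
have [l [b [h [l0 la [hm hs] hc conj]]]] := affine_normal_form g2.
pose E1 z := E (l * z + b).
have hE1 : infinite_pred E1.
  move=> [s hs']; apply: hE; exists [seq l * z + b | z <- s] => z Ez.
  apply/mapP; exists ((z - b) / l); last by field.
  by apply: hs'; rewrite /E1 (_ : _ + b = z) //; field.
have cl : 0 < cabs l by rewrite cabs_gt0.
have bE1 z : E1 z -> cabs z <= (B + cabs b) / cabs l.
  move=> /bE Ez; rewrite ler_pdivlMr // mulrC -cabsM -lerBlDr.
  by apply: le_trans Ez; have := cabsB_ge (l * z) (- b); rewrite cabsN opprK.
have inv1 z : E1 h.[z] -> E1 z by rewrite /E1 conj => /invg.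
have diam1 x y : E1 x -> E1 y -> cabs (x - y) <= 2 * rho / cabs l.
  move=> Ex Ey; rewrite ler_pdivlMr // mulrC -cabsM.
  have -> : l * (x - y) = (l * x + b) - (l * y + b) by ring.
  exact: hdiam.
have h2 : (2 < size h)%N by rewrite hs.
have := diam_ge2_of_monic hE1 bE1 hm h2 inv1 diam1.
(* The rescaled set has diameter at most 2 rho / |l|, so |l| <= rho, where |l|^(d-1) |a| = 1. *)
rewrite ler_pdivlMr // ler_pM2l // => l_rho.
have ca : cabs l ^+ (size g).-2 * cabs (lead_coef g) = 1.
  by rewrite -cabsX -cabsM la cabs1.
split.
  by rewrite -ca mulrC ler_wpM2l ?cabs_ge0 // lerXn2r ?nnegrE ?cabs_ge0 // ltW.
move=> eq1.
have lE : cabs l = rho.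
  have lg : 0 < cabs (lead_coef g) by rewrite cabs_gt0 lead_coef_eq0 -size_poly_gt0 (ltn_trans _ g2).
  apply/eqP; rewrite -(@eqrXn2 _ (size g).-2) ?cabs_ge0 ?(ltW rho0) //; last first.
    by move: g2; case: (size g) => [|[|[]]].
  by apply/eqP/(mulfI (lt0r_neq0 lg)); rewrite eq1 mulrC ca.
have diam2 x y : E1 x -> E1 y -> cabs (x - y) <= 2.
  by move=> Ex Ey; have := diam1 x y Ex Ey; rewrite lE mulfK // gt_eqF.
have hX := rigidity_monic hE1 bE1 hm h2 inv1 diam2 hc.
(* In the coordinate y the map is y^d and |y| <= 1, so z moves by |l| |y^d - y| <= 2 rho. *)
move=> z Ez; pose y := (z - b) / l.
have zy : z = l * y + b by rewrite /y; field.
have Ey : E1 y by rewrite /E1 -zy.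
have d1 : (1 < (size h).-1)%N by move: h2; case: (size h) => [|[|[]]].
have y1 : cabs y <= 1.
  apply: (pure_power_bound hE1 d1 _ diam2 Ey) => x.
  by rewrite -hornerXn -hX; exact: inv1.
rewrite zy -conj hX hornerXn.
have -> : l * y ^+ (size h).-1 + b - (l * y + b) = l * (y ^+ (size h).-1 - y) by ring.
rewrite cabsM lE mulrC ler_wpM2r ?(ltW rho0) //.
apply: le_trans (cabsD _ _) _; rewrite cabsN cabsX.
by apply: (@lerD _ _ 1 _ 1) => //; rewrite exprn_ile1 ?cabs_ge0.
Qed.

(** * The Julia set *)

Lemma normE (R : realType) (z : plane R) : `|z| = (cabs z)%:C.
Proof. by []. Qed.

Lemma norm_lt (R : realType) (z : plane R) (e : R[i]) :
  0 < e -> (`|z| < e) = (cabs z < complex.Re e).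
Proof.
by case: e => a b; rewrite ltcE /= => /andP[/eqP-> _]; rewrite normE ltcE /= eqxx.
Qed.

Lemma le_ReIm_cabs (R : realType) (z : R[i]) :
  `|complex.Re z| <= cabs z /\ `|complex.Im z| <= cabs z.
Proof.
have := cabs_sqrE z; have := cabs_ge0 z; set c := cabs z => c0 e.
have r2 := sqr_ge0 (complex.Re z); have i2 := sqr_ge0 (complex.Im z).
by split; rewrite -ler_sqr ?nnegrE // real_normK ?num_real //; lra.
Qed.

Lemma le_cabs_ReIm (R : realType) (z : R[i]) :
  cabs z <= `|complex.Re z| + `|complex.Im z|.
Proof.
rewrite -ler_sqr ?nnegrE ?cabs_ge0 ?addr_ge0 // cabs_sqrE.
have := normr_ge0 (complex.Re z); have := normr_ge0 (complex.Im z).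
by rewrite -[complex.Re z ^+ 2]real_normK ?num_real // -[complex.Im z ^+ 2]real_normK ?num_real //; nra.
Qed.

Lemma continuous_ReIm (R : realType) :
  continuous (fun p : R * R => (p.1 +i* p.2)%C : plane R).
Proof.
move=> p; apply/cvgrPdist_lt => e e0.
have e2 : 0 < complex.Re e by move: e0; rewrite ltcE => /andP[].
have ep : 0 < complex.Re e / 4 by rewrite divr_gt0.
exists (ball p.1 (complex.Re e / 4), ball p.2 (complex.Re e / 4)) => /=.
  by split; exact: nbhsx_ballx.
move=> q [/= b1 b2]; rewrite norm_lt //.
apply: le_lt_trans (le_cabs_ReIm _) _ => /=.
move: b1 b2; rewrite /ball /= => b1 b2; lra.
Qed.

(** Squares serve as compact neighbourhoods, being images of products of segments. *)
Definition square (R : realType) (z : R[i]) (r : R) : set (plane R) :=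
  (fun p : R * R => (p.1 +i* p.2)%C) @`
    (`[complex.Re z - r, complex.Re z + r]%classic
       `*` `[complex.Im z - r, complex.Im z + r]%classic).

Lemma compact_square (R : realType) (z : R[i]) (r : R) : compact (square z r).
Proof.
apply: continuous_compact; first exact/continuous_subspaceT/continuous_ReIm.
by apply: compact_setX; exact: segment_compact.
Qed.

Lemma squareP (R : realType) (z w : R[i]) (r : R) :
  square z r w <-> `|complex.Re (w - z)| <= r /\ `|complex.Im (w - z)| <= r.
Proof.
case: z w => x y [a b]; split=> [[[c e] [/= h1 h2] [<- <-]]|[/= h1 h2]].
  move: h1 h2; rewrite !in_itv /= => /andP[? ?] /andP[? ?].
  by rewrite !ler_norml; split; lra.
exists (a, b) => //=; move: h1 h2; rewrite /= !in_itv /= !ler_norml.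
by move=> /andP[? ?] /andP[? ?]; split; apply/andP; split; lra.
Qed.

(** A quantitative open mapping property: if all roots of f - w were at distance at least r from z,
    factoring would give |f(z) - w| >= |a| r^d. *)
Lemma root_near (R : realType) (f : {poly R[i]}) (z w : R[i]) (r : R) :
  (1 < size f)%N -> 0 < r ->
  cabs (f.[z] - w) < cabs (lead_coef f) * r ^+ (size f).-1 ->
  exists2 x, f.[x] = w & cabs (x - z) < r.
Proof.
move=> f1 r0 H; apply: contrapT => nx.
have far x : x \in roots_of f w -> r <= cabs (z - x).
  move=> xr; rewrite leNgt; apply/negP => xz; apply: nx; exists x.
    by move: xr; rewrite mem_roots_of // => /eqP.
  by rewrite cabsC.
move: H; rewrite ltNge => /negP; apply.
have -> : f.[z] - w = (f - w%:P).[z] by rewrite hornerD hornerN hornerC.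
rewrite roots_ofE // hornerZ cabsM ler_wpM2l ?cabs_ge0 //.
rewrite -(size_roots_of w f1) horner_prod cabs_prod.
rewrite -[in leLHS]count_predT -iter_mulr_1 -big_const_seq.
rewrite big_seq [leRHS]big_seq; apply: ler_prod => x xr.
by rewrite (ltW r0) hornerXsubC far.
Qed.

Lemma sphere_map_comp (R : realType) (f g : {poly R[i]}) (x : sphere R) :
  sphere_map (f \Po g) x = sphere_map f (sphere_map g x).
Proof. by case: x => //= z; rewrite horner_comp. Qed.

(** For p_n in S the maps p_n o f are in S, so a subsequence converges uniformly on a compact square
    around z. By [root_near] every point near f(z) is the image of a point of this square, so the
    p_n converge uniformly near f(z). *)
Lemma fatou_forward (R : realType) (S : set {poly R[i]}) (f : {poly R[i]})
    (z : R[i]) :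
  polynomial_semigroup S -> S f -> Defs.fatou S (Some z) -> Defs.fatou S (Some f.[z]).
Proof.
move=> [Scomp Ssize _ _] Sf [U [oU nU] Uz].
have f1 := Ssize f Sf.
have [r r0 rU] : exists2 r : R, 0 < r & Some @` square z r `<=` U.
  have : nbhs (z : plane R) (Some @^-1` U).
    by apply: (@one_point_compactification_some_continuous (plane R) z U);
       exact: open_nbhs_nbhs.
  move=> /nbhs_ballP[e /= e0 eU].
  have e2 : 0 < complex.Re e by move: e0; rewrite ltcE => /andP[].
  exists (complex.Re e / 4); first by rewrite divr_gt0.
  move=> _ [w /squareP[w1 w2] <-]; apply: eU; rewrite -ball_normE /=.
  rewrite norm_lt // cabsC.
  apply: le_lt_trans (le_cabs_ReIm _) _; lra.
pose K' : set (sphere R) := Some @` square z r.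
have cK' : compact K'.
  apply: continuous_compact; last exact: compact_square.
  exact/continuous_subspaceT/one_point_compactification_some_continuous.
pose s := cabs (lead_coef f) * r ^+ (size f).-1.
have s0 : 0 < s.
  rewrite mulr_gt0 ?exprn_gt0 // cabs_gt0 lead_coef_eq0 -size_poly_gt0.
  exact: ltn_trans f1.
pose V : set (sphere R) := Some @` [set w : plane R | cabs (f.[z] - w) < s].
have oV : open V.
  apply: one_point_compactification_open_some.
  have -> : [set w : plane R | cabs (f.[z] - w) < s] =
      ball (f.[z] : plane R) (s%:C : R[i]).
    by apply/seteqP; split=> w; rewrite -ball_normE /= normE ltcR.
  by apply: ball_open; rewrite ltcR.
(* A set-theoretic section of f over V with values in the square; outside V its value is a dummy. *)
have lift y : exists x, V y -> K' x /\ sphere_map f x = y.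
  have [[w /= ws <-]|nV] := pselect (V y); last by exists None.
  have [x fx xz] := root_near f1 r0 ws.
  exists (Some x) => _; split; last by rewrite /= fx.
  exists x => //; apply/squareP; have [h1 h2] := le_ReIm_cabs (x - z).
  by split; [apply: le_trans h1 _|apply: le_trans h2 _]; exact: ltW.
have /choice[pre hpre] := lift.
exists V; last by exists f.[z] => //=; rewrite subrr cabs0.
split=> // F hF.
have /choice[p hp] : forall n, exists q, S q /\ sphere_map q = F n.
  by move=> n; have [q Sq <-] := hF n; exists q.
have [|phi [h [mphi hconv]]] := nU (fun n => sphere_map (p n \Po f)).
  by move=> n; exists (p n \Po f) => //; apply: Scomp => //; have [] := hp n.
exists phi, (h \o pre); split=> // K cK KV e e0.
have [M hM] := hconv K' cK' rU e e0.
exists M => n Mn y Ky; have [K'p fy] := hpre y (KV y Ky).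
have := hM n Mn _ K'p; rewrite sphere_map_comp fy.
by have [_ ->] := hp (phi n).
Qed.

Lemma juliaC_backward (R : realType) (S : set {poly R[i]}) (f : {poly R[i]})
    (z : R[i]) :
  polynomial_semigroup S -> S f -> juliaC S f.[z] -> juliaC S z.
Proof. by move=> hS Sf nF F; apply: nF; exact: fatou_forward. Qed.

(* A finite backward invariant set is permuted by each map of the semigroup.  *)
Lemma finite_backward_invariant_forward (R : realType) (E : R[i] -> Prop)
    (f : {poly R[i]}) (z : R[i]) :
  ~ infinite_pred E -> (1 < size f)%N -> (forall w, E f.[w] -> E w) ->
  E z -> E f.[z].
Proof.
move=> /contrapT[s0 hs0] f1 invf Ez.
pose s := undup [seq x <- s0 | `[< E x >]].
have sE x : (x \in s) = `[< E x >].
  by rewrite mem_undup mem_filter; case: asboolP => // /hs0 ->.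
have /choice[pre hpre] : forall w, exists x, f.[x] = w.
  move=> w; have := size_roots_of w f1; case E1 : (roots_of f w) => [|x t] sz.
    by move: sz f1; case: (size f) => [|[]].
  by exists x; apply/eqP; rewrite -mem_roots_of // E1 inE eqxx.
have inj : injective pre by move=> x y e; rewrite -(hpre x) e hpre.
have sub : {subset [seq pre x | x <- s] <= s}.
  move=> _ /mapP[x xs ->]; rewrite sE; apply/asboolP/invf; rewrite hpre.
  by apply/asboolP; rewrite -sE.
have us : uniq [seq pre x | x <- s] by rewrite map_inj_uniq // undup_uniq.
have ss : (size s <= size [seq pre x | x <- s])%N by rewrite size_map.
have [_ eqs] := uniq_min_size us sub ss.
have : z \in s by rewrite sE; apply/asboolP.
by rewrite -eqs => /mapP[x xs ->]; rewrite hpre; apply/asboolP; rewrite -sE.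
Qed.

Lemma prod_ge1_eq1 (R : realType) (T : eqType) (F : T -> R) (s : seq T) :
  (forall x, x \in s -> 1 <= F x) -> \prod_(x <- s) F x = 1 ->
  forall x, x \in s -> F x = 1.
Proof.
elim: s => [|y s IH] // hF; rewrite big_cons => e.
have y1 : 1 <= F y by apply: hF; rewrite inE eqxx.
have hs x : x \in s -> 1 <= F x by move=> xs; apply: hF; rewrite inE xs orbT.
have s1 : 1 <= \prod_(x <- s) F x.
  rewrite big_seq; apply: (big_ind (fun u => 1 <= u)) => // u v u1 v1; nra.
have yE : F y = 1 by nra.
have sE : \prod_(x <- s) F x = 1 by nra.
by move=> x; rewrite inE => /predU1P[->//|]; exact: IH.
Qed.

Lemma bounded_orbit (R : realType) (S : set {poly R[i]}) (z : R[i]) (C : R) :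
  (forall f, S f -> cabs f.[z] <= C) -> bounded_set (semigroup_orbit S z).
Proof.
move=> hC; exists C%:C; split; first by rewrite complex_real.
move=> M CM _ [f Sf <-]; apply: le_trans (ltW CM).
by rewrite normE lecR hC.
Qed.

(** The leading coefficient of g o h is a_g a_h^(d_g), and d_g d_h - 1 = (d_g - 1) + d_g (d_h -
    1). *)
Lemma compositions_lead_coef (R : realType) (rho : R) (A : set {poly R[i]})
    (f : {poly R[i]}) :
  (forall g, A g -> (1 < size g)%N) ->
  (forall g, A g -> cabs (lead_coef g) * rho ^+ (size g).-2 = 1) ->
  compositions A f -> cabs (lead_coef f) * rho ^+ (size f).-2 = 1.
Proof.
move=> A1 hA [s [_ sA ->]].
suff [] : (1 < size (foldr (fun g h => g \Po h) 'X s))%N /\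
  cabs (lead_coef (foldr (fun g h => g \Po h) 'X s)) *
  rho ^+ (size (foldr (fun g h => g \Po h) 'X s)).-2 = 1 by [].
elim: s sA => [|g s IH] sA /=.
  by rewrite size_polyX lead_coefX cabs1 mulr1.
have [h1 hl] := IH (fun k ks => sA k (mem_behead (s := g :: s) ks)).
set h := foldr _ _ _ in h1 hl *.
have Ag : A g by apply: sA; rewrite inE eqxx.
have g1 := A1 g Ag; have hg := hA g Ag.
have sc : (size (g \Po h)).-1 = ((size g).-1 * (size h).-1)%N by rewrite size_comp_poly.
have [m sg] : exists m, size g = m.+2 by case: (size g) g1 => [|[|m]] // _; exists m.
have [n sh] : exists n, size h = n.+2 by case: (size h) h1 => [|[|n]] // _; exists n.
rewrite sg sh /= in sc hg hl; split; first by move: sc; case: (size _) => [|[|]].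
rewrite (_ : (size (g \Po h)).-2 = (m + m.+1 * n)%N); last by rewrite sc mulnS; lia.
rewrite lead_coef_comp // sg /= cabsM cabsX exprD -[RHS](mulr1 1) -{1}hg.
rewrite -[X in _ = _ * X](expr1n _ m.+1) -hl exprMn -exprM [(m.+1 * n)%N]mulnC.
ring.
Qed.

Unset Implicit Arguments.

Theorem corollary7p4 (R : realType) (S : set {poly R[i]})
    (GS : seq {poly R[i]})
    (S_polysemigroup : polynomial_semigroup S)
    (S_finitely_generated : finitely_generated S)
    (GS_minimal : minimal_generating_set S GS)
    (C_exceptional : (exists c, Cstar GS = [set c]) ->
       [set (Some c : sphere R) | c in Ccrit S GS] `&` exceptional S = set0)
    (orbit_hyp : exists z0 : plane R,
       [/\ juliaC S z0, ~ bounded_set (semigroup_orbit S z0)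
         & ~ dense (semigroup_orbit S z0)])
    (G : seq {poly R[i]})
    (G_generates : generating_set S G)
    (S_degree : forall f, S f -> (2 <= degree f)%N) :
  let N := size G in
  let D := (\sum_(g <- G) degree g)%N in
  ((2 * powR (cabs (\prod_(g <- G) lead_coef g)) (1 / (N%:R - D%:R)))%:E
     < diam (juliaC S))%E.
Proof.
have [z0 [Jz0 nb _]] := orbit_hyp; cbv zeta.
set N := size G; set D := (\sum_(g <- G) degree g)%N.
set rho := powR _ _; rewrite ltNge; apply/negP => diam_le.
have [_ Ssize _ [f0 Sf0 _]] := S_polysemigroup.
have [_ [GS' SG]] := G_generates.
have Ginv f z : S f -> juliaC S f.[z] -> juliaC S z.
  by move=> Sf; exact: juliaC_backward.
have Ssize3 f : S f -> (2 < size f)%N.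
  by move/S_degree; rewrite /degree; case: (size f).
have SGmem g : g \in G -> S g by move=> gG; apply: GS'.
(* A finite J(S) would be mapped into itself by S, and the orbit of z0 would be bounded. *)
have Jinf : infinite_pred (juliaC S).
  apply: contrapT => fin; apply: nb.
  have [s hs] := contrapT fin.
  apply: (@bounded_orbit _ _ _ (\sum_(x <- s) cabs x)) => f Sf.
  have Jf : juliaC S f.[z0].
    by apply: (finite_backward_invariant_forward fin (Ssize f Sf)) => // w; exact: Ginv.
  rewrite (big_rem _ (hs _ Jf)) /= lerDl; apply: sumr_ge0 => x _.
  exact: cabs_ge0.
pose P := cabs (\prod_(g <- G) lead_coef g).
have P0 : 0 < P.
  rewrite /P cabs_prod big_seq; apply: (big_ind (fun u => 0 < u)) => //.
    by move=> u v; exact: mulr_gt0.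
  move=> g /SGmem /Ssize g1; rewrite cabs_gt0 lead_coef_eq0 -size_poly_gt0.
  exact: ltn_trans g1.
have rho0 : 0 < rho by exact: powR_gt0.
pose k := (\sum_(g <- G) (size g).-2)%N.
have DE : D = (k + N)%N.
  rewrite /D /k /N -sum1_size -big_split /=; apply: eq_big_seq => g /SGmem /Ssize3.
  by rewrite /degree; case: (size g) => [|[|n]] //; rewrite /= addn1.
have k0 : (0 < k)%N.
  have [s [s0 sG _]] := SG _ Sf0.
  case: s s0 sG => [|g s] // _ /(_ g); rewrite inE eqxx => /(_ isT) gG.
  rewrite /k (big_rem g) //= addn_gt0; apply/orP; left.
  by have := Ssize3 _ (SGmem _ gG); case: (size g) => [|[|[]]].
(* Since k = D - N, the exponent 1 / (N - D) makes the product of |a| rho^(d-1) over the generators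
   equal to 1. *)
have rhok : P * rho ^+ k = 1.
  rewrite -powR_mulrn ?powR_ge0 // -powRrM -/P.
  rewrite (_ : _ * k%:R = -1); last first.
    have kn : k%:R != 0 :> R by rewrite pnatr_eq0 -lt0n.
    rewrite DE natrD (_ : N%:R - (k%:R + N%:R) = - k%:R); last by ring.
    by rewrite invrN mulrN mul1r mulNr mulVf.
  by rewrite powR_inv1 ?ltW // mulfV // gt_eqF.
have Jdiam x y : juliaC S x -> juliaC S y -> cabs (x - y) <= 2 * rho.
  move=> Jx Jy; rewrite -lee_fin; apply: le_trans diam_le.
  by apply: ereal_sup_ubound; exists (x, y).
have Jbound z : juliaC S z -> cabs z <= cabs z0 + 2 * rho.
  move=> Jz; have := Jdiam z z0 Jz Jz0; have := cabsB_ge z z0; lra.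
have low g : g \in G -> 1 <= cabs (lead_coef g) * rho ^+ (size g).-2.
  move=> /SGmem Sg.
  by have [] := backward_invariant_diam Jinf Jbound (Ssize3 _ Sg)
    (fun z => @Ginv g z Sg) rho0 Jdiam.
(* Factors that are at least 1 and have product 1 are all equal to 1. *)
have Gone g : g \in G -> cabs (lead_coef g) * rho ^+ (size g).-2 = 1.
  apply: prod_ge1_eq1 low _ g.
  by rewrite big_split /= -cabs_prod -/P prodrXr -/k.
have Sone f : S f -> cabs (lead_coef f) * rho ^+ (size f).-2 = 1.
  move=> /SG; apply: compositions_lead_coef => // g gG.
  exact: Ssize (SGmem _ gG).
(* By the equality case every f in S moves z0 by at most 2 rho. *)
apply: nb; apply: (@bounded_orbit _ _ _ (cabs z0 + 2 * rho)) => f Sf.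
have [_ /(_ (Sone f Sf) z0 Jz0)] := backward_invariant_diam Jinf Jbound
  (Ssize3 _ Sf) (fun z => @Ginv f z Sf) rho0 Jdiam.
by have := cabsB_ge f.[z0] z0; lra.
Qed.
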